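(* Let $\mu$ be a probability measure on $X$ and let $\alpha$ be a Young function satisfying the $\Delta_2$-condition, with associated exponents $1\le r_\alpha\le p_\alpha$, $p_\alpha>1$ defined by $$r_\alpha=\inf_{x>0}\frac{x\alpha'_-(x)}{\alpha(x)},\qquad p_\alpha=\sup_{x>0}\frac{x\alpha'_+(x)}{\alpha(x)}.$$ (i) If $\mu$ satisfies $\mathbf{LSI}^+_\alpha(A)$ for some $A>0$, then $\mu$ satisfies $\mathbf{T}_\alpha(C^+)$ with $$C^+=\max\left(\big((p_\alpha-1)A\big)^{r_\alpha-1}\,;\,\big((p_\alpha-1)A\big)^{p_\alpha-1}\right).$$ (ii) If $\mu$ satisfies $\mathbf{LSI}^-_\alpha(A)$ for some $A>0$, then $\mu$ satisfies $\mathbf{T}_\alpha(C^-)$ with $$C^-=\big(1+(p_\alpha-1)A\big)^{p_\alpha-r_\alpha}\big((p_\alpha-1)A\big)^{r_\alpha-1}.$$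
   Context: Throughout, $(X,d)$ is a complete separable metric space whose closed balls are compact; measures are Borel. A Young function is an even convex function $\alpha:\mathbb{R}\to\mathbb{R}^+$ (finite valued), increasing on $\mathbb{R}^+$, with $\alpha(0)=0$ and $\alpha'(0)=0$. It satisfies the $\Delta_2$-condition if there is a constant $K>0$ with $\alpha(2x)\le K\alpha(x)$ for all $x\in\mathbb{R}$. $\alpha'_+$ and $\alpha'_-$ denote right and left derivatives. The Fenchel--Legendre transform is $\alpha^*(y)=\sup_{x\in\mathbb{R}}\{xy-\alpha(x)\}\in\mathbb{R}^+\cup\{\infty\}$. Optimal transport cost: $\mathcal{T}_\alpha(\nu,\mu)=\inf_\pi\iint\alpha(d(x,y))\,d\pi(x,y)$, the infimum being over all probability measures $\pi$ on $X\times X$ with marginals $\nu$ and $\mu$. Relative entropy: $H(\nu|\mu)=\int\log\frac{d\nu}{d\mu}\,d\nu$ if $\nu\ll\mu$, and $+\infty$ otherwise. $\mu$ satisfies $\mathbf{T}_\alpha(C)$ if $\mathcal{T}_\alpha(\nu,\mu)\le C\,H(\nu|\mu)$ for all probability measures $\nu$ on $X$. A function $f:X\to\mathbb{R}$ is locally Lipschitz if every $x\in X$ is the center of a ball $B$ with $\sup_{y,z\in B,\,y\ne z}\frac{|f(y)-f(z)|}{d(y,z)}<\infty$. For such $f$, $|\nabla^{\pm}f|(x)=\limsup_{y\to x}\frac{[f(y)-f(x)]_{\pm}}{d(y,x)}$ if $x$ is not isolated and $0$ otherwise, where $[a]_+=\max(a;0)$, $[a]_-=\max(-a;0)$. For $g>0$,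 $\mathrm{Ent}_\mu(g)=\int g\log\frac{g}{\int g\,d\mu}\,d\mu$. $\mu$ satisfies $\mathbf{LSI}^+_\alpha(A)$ (resp. $\mathbf{LSI}^-_\alpha(A)$) if $\mathrm{Ent}_\mu(e^f)\le A\int\alpha^*(|\nabla^+f|)e^f\,d\mu$ (resp. $\mathrm{Ent}_\mu(e^f)\le A\int\alpha^*(|\nabla^-f|)e^f\,d\mu$) for all bounded locally Lipschitz $f:X\to\mathbb{R}$. *)

(* Defs.v *)
From HB Require Import structures.
From mathcomp Require Import all_boot all_order all_algebra.
From mathcomp Require Import all_classical all_reals all_analysis.

Set Implicit Arguments.
Unset Strict Implicit.
Unset Printing Implicit Defensive.

Import Order.TTheory GRing.Theory Num.Theory.
Import numFieldTopology.Exports numFieldNormedType.Exports.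

Local Open Scope classical_set_scope.
Local Open Scope ring_scope.

HB.mixin Record isBorelMeasurable (d : measure_display) T
    & Measurable d T & Topological T := {
  borel_measurableE : @measurable d T = <<s [set U : set T | open U] >>
}.

(* The library's measurable types and complete uniform spaces are pointed; here
   this only excludes the empty space, which carries no probability measure. *)
#[short(type="completeBorelMetricType")]
HB.structure Definition CompleteBorelMetric (d : measure_display)
    (R : numDomainType) :=
  {T of Metric R T & Complete T & Measurable d T & isBorelMeasurable d T}.

Definition separable (T : topologicalType) :=
  exists2 D : set T, countable D & dense D.

(* Not the library's [closed_ball], which is the closure of the open ball. *)
Definition compact_closed_balls (R : realType) (X : metricType R) :=
  forall (x : X) (r : R), compact [set y : X | mdist x y <= r].

Section young.
Context {R : realType}.
Implicit Type alpha : R -> R.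

(* [is_derive] states both that alpha is derivable at 0 and that the
   derivative is 0. *)
Record young_function alpha : Prop := YoungFunction {
  young_ge0 : forall x : R, 0 <= alpha x ;
  young_even : forall x : R, alpha (- x) = alpha x ;
  young_convex : convex_function (E := R^o) setT alpha ;
  young_increasing : forall x y : R, 0 <= x -> x < y -> alpha x < alpha y ;
  young0 : alpha 0 = 0 ;
  young_derive0 : is_derive (0 : R) (1 : R) alpha 0
}.

Definition delta2 alpha :=
  exists2 K : R, 0 < K & forall x, alpha (2 * x) <= K * alpha x.

Definition right_derivative (f : R -> R) (x : R) : R :=
  lim ((f (x + h) - f x) / h @[h --> 0^'+]).

Definition left_derivative (f : R -> R) (x : R) : R :=
  lim ((f (x + h) - f x) / h @[h --> 0^'-]).

(* [inf] and [sup] on R are 0 when the infimum or the supremum is not finite: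
   1 <= r_exponent alpha and 1 < p_exponent alpha imply that they are finite. *)
Definition r_exponent alpha : R :=
  inf [set x * left_derivative alpha x / alpha x | x in [set x : R | 0 < x]].

Definition p_exponent alpha : R :=
  sup [set x * right_derivative alpha x / alpha x | x in [set x : R | 0 < x]].

Definition fenchel alpha (y : R) : \bar R :=
  ereal_sup [set (x * y - alpha x)%:E | x in [set: R]].

End young.

Section transport_entropy.
Local Open Scope ereal_scope.
Context {d : measure_display} {R : realType}.
Variable X : completeBorelMetricType d R.
Implicit Types (mu nu : probability X R) (alpha : R -> R).

(* The product sigma-algebra on X * X is its Borel sigma-algebra when X is
   separable. *)
Definition couplings nu mu : set (probability (X * X)%type R) :=
  [set pi | forall A : set X, measurable A ->
     pi (fst @^-1` A) = nu A /\ pi (snd @^-1` A) = mu A].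

Definition transport_cost alpha nu mu : \bar R :=
  ereal_inf [set \int[pi]_z (alpha (mdist z.1 z.2))%:E
            | pi in couplings nu mu].

Definition relative_entropy nu mu : \bar R :=
  if `[< nu `<< mu >] then
    \int[nu]_x (ln (fine (Radon_Nikodym (charge_of_finite_measure nu) mu x)))%:E
  else +oo.

Definition transport_entropy alpha mu (C : R) :=
  forall nu, transport_cost alpha nu mu <= C%:E * relative_entropy nu mu.

End transport_entropy.

Section log_sobolev.
Context {d : measure_display} {R : realType}.
Variable X : completeBorelMetricType d R.
Implicit Types (mu : probability X R) (alpha : R -> R) (f : X -> R).

Definition locally_lipschitz f :=
  forall x : X, exists2 r : R, 0 < r &
    has_ubound [set `|f yz.1 - f yz.2| / mdist yz.1 yz.2
               | yz in [set yz : X * X |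
                   [/\ ball x r yz.1, ball x r yz.2 & yz.1 != yz.2]]].

Definition pos_part (a : R) : R := Num.max a 0.
Definition neg_part (a : R) : R := Num.max (- a) 0.

(* The upper limit is taken in \bar R over the punctured neighbourhoods of x;
   it is finite when f is locally Lipschitz and x is not isolated. *)
Definition slope (part : R -> R) f (x : X) : R :=
  if `[< isolated [set: X] x >] then 0
  else fine (limf_esup (fun y : X => (part (f y - f x) / mdist y x)%:E) x^').

Definition slope_plus f : X -> R := slope pos_part f.
Definition slope_minus f : X -> R := slope neg_part f.

Definition entropy mu (g : X -> R) : \bar R :=
  (\int[mu]_x (g x * ln (g x / \int[mu]_y g y)%R)%:E)%E.

Definition LSI_plus alpha mu (A : R) :=
  forall f, bounded_fun f -> locally_lipschitz f ->
    (entropy mu (expR \o f) <=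
     A%:E * \int[mu]_x (fenchel alpha (slope_plus f x) * (expR (f x))%:E))%E.

Definition LSI_minus alpha mu (A : R) :=
  forall f, bounded_fun f -> locally_lipschitz f ->
    (entropy mu (expR \o f) <=
     A%:E * \int[mu]_x (fenchel alpha (slope_minus f x) * (expR (f x))%:E))%E.

End log_sobolev.

(* Main.v *)
(** Write Q_t f(x) = inf_z f(z) + t alpha(d(x,z)/t).  Convexity of alpha gives
    Q_(t+h) f(x) <= Q_t f(y) + h alpha(d(x,y)/h); letting y tend to x with
    h = d(x,y)/w for an arbitrary w > 0 yields the Hamilton-Jacobi inequality
    alpha*(|grad^+- Q_t f|) <= - d/dt Q_t f, for both gradients, without any
    geodesic or compactness assumption.  The time derivative exists because
    alpha is first replaced by its average over the scales [1, k], which lies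
    below alpha, keeps its two scaling inequalities, and makes Q_t f
    semiconcave in t; at the end k tends to 1.

    The logarithmic Sobolev inequality applied to k(t) Q_t f, with
    k(t) = (t/a)^(p-1) for t <= a and k(t) = (t/a)^(r-1) for t >= a, where
    a = (p-1)A, makes t |-> log (int exp(k(t) Q_t f) dmu) / k(t) nonincreasing.
    Comparing t = 0 and t = 1 gives
    int exp(Q_1 f / C+) dmu <= exp(int f dmu / C+), which by the Gibbs
    variational principle bounds the dual Kantorovich functional by C+ H.
    Hence T_alpha(C+) in both cases, and C+ <= C-.

    Kantorovich duality is only needed up to an error: on a countable partition
    of X into small cells, the Hahn-Banach theorem turns the dual bound into a
    positive functional on bounded functions on nat * nat, hence into a
    discrete plan (no mass escapes since the marginals are tight), and the plan
    is realized by multiples of the product measure on products of cells. *)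

Require Import Defs.
From HB Require Import structures.
From mathcomp Require Import all_boot all_order all_algebra.
From mathcomp Require Import all_classical all_reals all_analysis.
From mathcomp Require Import measurable_realfun.
From mathcomp Require Import ring lra.

Set Implicit Arguments.
Unset Strict Implicit.
Unset Printing Implicit Defensive.

Import Order.TTheory GRing.Theory Num.Theory.
Import numFieldTopology.Exports numFieldNormedType.Exports.

Local Open Scope classical_set_scope.
Local Open Scope ring_scope.

(** * Convex costs *)

(** The form k = s^m, s = t/a, comes from one cancellation. Up to normalization, the derivative of
    log (int exp(k Q_t f) dmu) / k is (k'/k^2) Ent plus the mean of d/dt Q_t f. Substituting w = s
    w' in the Legendre transform, the scaling al(s u) >= s^(m+1) al(u) shows that the conjugate at
    s^m y is at most s^(m+1) times the conjugate at y. Hence Ent is at most A s^(m+1) times the mean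
    of - d/dt Q_t f, and since k'/k^2 = (m/a) s^(-m-1), the sum is nonpositive as soon as m A <= a.
    The scaling is available with m = p-1 for s <= 1 and with m = r-1 for s >= 1, so the regimes
    meet at s = 1.

    In the proof these derivatives are finite increments with an error of order h^2, summed over a
    subdivision. This avoids differentiating under the integral, and it settles measurability: the
    right-hand side of the logarithmic Sobolev inequality is bounded at once by a difference
    quotient of Q_t f, which is bounded and measurable, whereas nothing is known about the
    slopes. *)

Section monotonicity.
Context {R : realType}.
Implicit Types g al : R -> R.

(** N equal steps accumulate an error of at most C (b - a)^2 / N, which vanishes as N grows. This
    replaces differentiation, both in time and in logarithmic scale. *)
Lemma quadratic_error_nonincreasing g (C a b : R) : a <= b ->
  (exists2 h0 : R, 0 < h0 & forall t h : R, a <= t -> 0 < h -> h <= h0 -> t + h <= b ->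
    g (t + h) <= g t + C * h ^+ 2) -> g b <= g a.
Proof.
move=> ab [h0 h00 H]; have [->//|neab] := eqVneq a b.
have l0 : 0 < b - a by rewrite subr_gt0 lt_neqAle neab.
apply/ler_addgt0Pl => e e0.
(* The first term of [N] brings the step below [h0], the second brings the accumulated error below
   [e]. *)
pose N := (Num.truncn ((b - a) / h0) + Num.truncn (`|C| * (b - a) ^+ 2 / e)).+1.
pose h := (b - a) / N%:R.
have N0 : 0 < N%:R :> R by rewrite ltr0n.
have hgt0 : 0 < h by rewrite divr_gt0.
have ge0_1 : 0 <= (b - a) / h0 by rewrite divr_ge0 ?ltW.
have ge0_2 : 0 <= `|C| * (b - a) ^+ 2 / e.
  by rewrite divr_ge0 ?mulr_ge0 ?sqr_ge0// ltW.
have t1 := truncnS_gt ((b - a) / h0).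
have t2 := truncnS_gt (`|C| * (b - a) ^+ 2 / e).
have N1 : (b - a) / h0 <= N%:R.
  by apply/ltW/(lt_le_trans t1); rewrite ler_nat ltnS leq_addr.
have N2 : `|C| * (b - a) ^+ 2 / e <= N%:R.
  by apply/ltW/(lt_le_trans t2); rewrite ler_nat ltnS leq_addl.
have hh0 : h <= h0 by rewrite /h ler_pdivrMr// mulrC -ler_pdivrMr.
have step n : (n <= N)%N -> g (a + n%:R * h) <= g a + n%:R * (C * h ^+ 2).
  elim: n => [_|n IH nN]; first by rewrite !mul0r !addr0.
  have nh : a + n.+1%:R * h <= b.
    rewrite -lerBrDl; apply: le_trans (_ : N%:R * h <= _).
      by rewrite ler_pM2r// ler_nat.
    by rewrite /h mulrC divfK// gt_eqF.
  have -> : a + n.+1%:R * h = a + n%:R * h + h by rewrite -natr1; ring.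
  apply: le_trans (H _ _ _ hgt0 hh0 _) _.
  - by rewrite lerDl mulr_ge0// ltW.
  - by rewrite (le_trans _ nh)// -natr1; lra.
  - by have := IH (ltnW nN); rewrite -natr1; lra.
have := step N (leqnn _).
have -> : a + N%:R * h = b by rewrite /h mulrC divfK ?gt_eqF//; ring.
move=> /le_trans; apply; rewrite addrC lerD2r.
have -> : N%:R * (C * h ^+ 2) = C * (b - a) ^+ 2 / N%:R.
  by rewrite /h; field; rewrite gt_eqF.
rewrite ler_pdivrMr//; apply: le_trans (_ : `|C| * (b - a) ^+ 2 <= _).
  by rewrite ler_wpM2r ?sqr_ge0// ler_norm.
by rewrite [leRHS]mulrC -ler_pdivrMr.
Qed.

End monotonicity.

Section convex_cost.
Context {R : realType}.
Implicit Types al : R -> R.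

(** A part of the Young axioms that averages over scales inherit. Positivity at 1 encodes growth: by
    convexity [al x >= x * al 1] for [x >= 1], which confines the near-minimizers of the Hopf-Lax
    formula to a bounded region. *)
Record convex_cost al : Prop := ConvexCost {
  cost_ge0 : forall x, 0 <= al x ;
  cost0 : al 0 = 0 ;
  cost_gt0 : 0 < al 1 ;
  cost_mono : forall x y, 0 <= x -> x <= y -> al x <= al y ;
  cost_conv : forall t x y, 0 <= t -> t <= 1 ->
    al (t * x + (1 - t) * y) <= t * al x + (1 - t) * al y
}.

(* Local semiconcavity of t |-> t * al (D / t), uniformly over bounded D. *)
Definition semiconcave_cost al := forall a Dm : R, 0 < a -> 0 <= Dm ->
  exists2 L, 0 <= L & forall D t0 t1 t2, 0 <= D -> D <= Dm ->
    a <= t0 -> t0 < t1 -> t1 < t2 ->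
    (t2 - t1) * (t0 * al (D / t0) - t1 * al (D / t1)) <=
    (t1 - t0) * (t1 * al (D / t1) - t2 * al (D / t2))
    + L * (t2 - t1) * (t1 - t0) * (t2 - t0).

Lemma young_convex_cost al : young_function al -> convex_cost al.
Proof.
move=> Y; split.
- exact: young_ge0.
- exact: young0.
- by rewrite -(young0 Y); apply: (young_increasing Y).
- move=> x y x0; rewrite le_eqVlt => /predU1P[->//|xy].
  exact/ltW/(young_increasing Y).
- move=> t x y t0 t1.
  have t01 : Itv.spec (@Itv.num_sem R) (Itv.Real `[0%Z, 1%Z]) t.
    by rewrite /Itv.spec/= /Itv.num_sem/= ger0_real//= in_itv/= t0 t1.
  have := @young_convex _ _ Y (Itv.mk t01) x y.
  by rewrite !inE; apply.
Qed.

Variable al : R -> R.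
Hypothesis A : convex_cost al.

Lemma cost_scale s x : 0 <= s -> s <= 1 -> al (s * x) <= s * al x.
Proof.
move=> s0 s1; have := cost_conv A x 0 s0 s1.
by rewrite (cost0 A) !mulr0 !addr0.
Qed.

(** The perspective (x, t) |-> t al(x / t) of a convex function is subadditive; the semigroup
    inequality for Q_t rests on it. *)
Lemma cost_perspective (x y t h : R) : 0 < t -> 0 < h ->
  (t + h) * al ((x + y) / (t + h)) <= t * al (x / t) + h * al (y / h).
Proof.
move=> t0 h0; have th0 : 0 < t + h by rewrite addr_gt0.
have := @cost_conv _ A (t / (t + h)) (x / t) (y / h).
have -> : t / (t + h) * (x / t) + (1 - t / (t + h)) * (y / h) =
  (x + y) / (t + h) by field; rewrite !gt_eqF.
move=> /(_ _ _)/(ler_wpM2l (ltW th0)).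
have -> : (t + h) * (t / (t + h) * al (x / t) + (1 - t / (t + h)) * al (y / h)) =
  t * al (x / t) + h * al (y / h) by field; rewrite !gt_eqF.
apply.
- by rewrite divr_ge0// ltW.
- by rewrite ler_pdivrMr// mul1r lerDl ltW.
Qed.

(** By convexity the increment is controlled by the chord from [a] to [B + 1]. That chord has length
    at least 1, so its slope is at most [al (B + 1)]; the extra unit prevents division by a short
    length. *)
Lemma cost_lip (B a b : R) : 0 <= a -> a <= b -> b <= B ->
  al b - al a <= (b - a) * al (B + 1).
Proof.
move=> a0 ab bB; have D0 : 0 < B + 1 - a by lra.
have := @cost_conv _ A ((b - a) / (B + 1 - a)) (B + 1) a.
have -> : (b - a) / (B + 1 - a) * (B + 1) + (1 - (b - a) / (B + 1 - a)) * a = b.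
  by field; rewrite gt_eqF.
set s := _ / _; have s0 : 0 <= s by apply: divr_ge0; lra.
have s1 : s <= b - a.
  by rewrite /s ler_pdivrMr// ler_peMr//; lra.
have s2 : s <= 1 by rewrite /s ler_pdivrMr//; lra.
move=> /(_ s0 s2) H.
have := cost_ge0 A a; have := cost_ge0 A (B + 1) => p1 p2.
have : s * al (B + 1) <= (b - a) * al (B + 1) by rewrite ler_wpM2r.
have : 0 <= s * al a by rewrite mulr_ge0.
lra.
Qed.

Lemma cost_slope_mono (x y z : R) : x < y -> y < z ->
  (al y - al x) / (y - x) <= (al z - al x) / (z - x)
  /\ (al z - al x) / (z - x) <= (al z - al y) / (z - y).
Proof.
move=> xy yz; have [p q] : 0 < y - x /\ 0 < z - y by lra.
have r : 0 < z - x by lra.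
have := @cost_conv _ A ((y - x) / (z - x)) z x.
have -> : (y - x) / (z - x) * z + (1 - (y - x) / (z - x)) * x = y.
  by field; rewrite gt_eqF.
have s0 : 0 <= (y - x) / (z - x) by rewrite divr_ge0// ltW.
have s1 : (y - x) / (z - x) <= 1 by rewrite ler_pdivrMr//; lra.
move=> /(_ s0 s1)/(ler_wpM2l (ltW r)).
have -> : (z - x) * ((y - x) / (z - x) * al z + (1 - (y - x) / (z - x)) * al x) =
  (y - x) * al z + (z - y) * al x by field; rewrite gt_eqF.
move=> H; split.
  rewrite ler_pdivrMr// mulrAC ler_pdivlMr//; lra.
rewrite ler_pdivrMr// mulrAC ler_pdivlMr//; lra.
Qed.

End convex_cost.

Section one_sided_derivatives.
Context {R : realType}.
Variable al : R -> R.
Hypothesis A : convex_cost al.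
Implicit Types x y z : R.

Let q x (h : R) := (al (x + h) - al x) / h.

Let q_mono x h k : h != 0 -> k != 0 -> h <= k -> q x h <= q x k.
Proof.
have e1 z : (al (x + z) - al x) / (x + z - x) = q x z.
  by rewrite addrAC subrr add0r.
have e2 z : (al x - al (x + z)) / (x - (x + z)) = q x z.
  by rewrite -(opprB (al (x + z))) -(opprB (x + z)) invrN mulrNN e1.
move=> h0 k0; rewrite le_eqVlt => /predU1P[->//|hk].
have [hp|hn|hz] := ltgtP 0 h; last by rewrite -hz eqxx in h0.
- have [+ _] := @cost_slope_mono _ _ A x (x + h) (x + k) ltac:(lra) ltac:(lra).
  by rewrite !e1.
- have [kp|kn|kz] := ltgtP 0 k; last by rewrite -kz eqxx in k0.
  + have [] := @cost_slope_mono _ _ A (x + h) x (x + k) ltac:(lra) ltac:(lra).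
    by rewrite e1 e2; exact: le_trans.
  + have [_] := @cost_slope_mono _ _ A (x + h) (x + k) x ltac:(lra) ltac:(lra).
    by rewrite !e2.
Qed.

Let right_cvg x : cvg (q x h @[h --> 0^'+]).
Proof.
apply: nondecreasing_at_right_is_cvgr.
- apply: nearW => z h k; rewrite !in_itv/= => /andP[h0 _] /andP[k0 _] hk.
  by apply: q_mono => //; rewrite gt_eqF.
- apply: nearW => z; exists (q x (-1)) => _ [h /= + <-]; rewrite in_itv/= => /andP[h0 _].
  by apply: q_mono; rewrite ?oppr_eq0 ?oner_eq0 ?gt_eqF//; lra.
Qed.

Let left_cvg x : cvg (q x h @[h --> 0^'-]).
Proof.
apply: nondecreasing_at_left_is_cvgr.
- apply: nearW => z h k; rewrite !in_itv/= => /andP[_ h0] /andP[_ k0] hk.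
  by apply: q_mono => //; rewrite lt_eqF.
- apply: nearW => z; exists (q x 1) => _ [h /= + <-]; rewrite in_itv/= => /andP[_ h0].
  by apply: q_mono; rewrite ?oner_eq0 ?lt_eqF//; lra.
Qed.

Lemma right_derivative_le x y : x < y ->
  right_derivative al x * (y - x) <= al y - al x.
Proof.
move=> xy; have y0 : 0 < y - x by lra.
rewrite -ler_pdivlMr//; apply: limr_le; first exact: right_cvg.
near=> h; have -> : (al y - al x) / (y - x) = q x (y - x) by rewrite /q addrCA subrr addr0.
have h0 : 0 < h by near: h; exact: nbhs_right_gt.
apply: q_mono; rewrite ?gt_eqF//; near: h; exact: nbhs_right_le.
Unshelve. all: by end_near. Qed.

Lemma left_derivative_ge x y : x < y ->
  al y - al x <= left_derivative al y * (y - x).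
Proof.
move=> xy; have y0 : 0 < y - x by lra.
rewrite -ler_pdivrMr//; apply: limr_ge; first exact: left_cvg.
near=> h; have -> : (al y - al x) / (y - x) = q y (x - y).
  by rewrite /q addrCA subrr addr0 -(opprB (al y)) -(opprB y) invrN mulrNN.
have h0 : h < 0 by near: h; exact: nbhs_left_lt.
apply: q_mono; rewrite ?lt_eqF//; first by lra.
near: h; apply: nbhs_left_ge; lra.
Unshelve. all: by end_near. Qed.

Lemma left_derivative_le_right x : left_derivative al x <= right_derivative al x.
Proof.
apply: limr_le; first exact: left_cvg.
near=> h; apply: limr_ge; first exact: right_cvg.
near=> k.
have h0 : h < 0 by near: h; exact: nbhs_left_lt.
have k0 : 0 < k by near: k; exact: nbhs_right_gt.
by apply: q_mono; [rewrite lt_eqF|rewrite gt_eqF|lra].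
Unshelve. all: by end_near. Qed.

End one_sided_derivatives.

(** * Power-type scaling bounds from the two exponents *)

Section exponents.
Context {R : realType}.
Variable al : R -> R.
Hypothesis Y : young_function al.
Hypothesis D2 : delta2 al.
Let A := young_convex_cost Y.
Local Notation r := (r_exponent al).
Local Notation p := (p_exponent al).

Lemma young_gt0 x : 0 < x -> 0 < al x.
Proof. by move=> x0; rewrite -(young0 Y); exact: (young_increasing Y). Qed.

Let left_ge1 x : 0 < x -> 1 <= x * left_derivative al x / al x.
Proof.
move=> x0; rewrite ler_pdivlMr ?young_gt0// mul1r mulrC.
by have := left_derivative_ge A x0; rewrite (young0 Y) !subr0.
Qed.

Let r_has_inf :
  has_inf [set x * left_derivative al x / al x | x in [set x : R | 0 < x]].
Proof.
split; first by exists (1 * left_derivative al 1 / al 1), 1 => //=.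
by exists 1 => _ [x x0 <-]; exact: left_ge1.
Qed.

Let p_has_sup :
  has_sup [set x * right_derivative al x / al x | x in [set x : R | 0 < x]].
Proof.
split; first by exists (1 * right_derivative al 1 / al 1), 1 => //=.
have [K K0 HK] := D2.
(* The supporting line at x, evaluated at 2x, gives x al'_+(x) <= al(2x) - al(x) <= (K - 1)
   al(x). *)
exists (K - 1) => _ [x /= x0 <-]; rewrite ler_pdivrMr ?young_gt0//.
have := @right_derivative_le _ _ A x (2 * x) ltac:(lra).
have := HK x; have -> : 2 * x - x = x by ring.
lra.
Qed.

Let r_le x : 0 < x -> r * al x <= x * left_derivative al x.
Proof.
move=> x0; rewrite -ler_pdivlMr ?young_gt0//.
by apply: ge_inf; [case: r_has_inf|exists x].
Qed.

Let le_p x : 0 < x -> x * right_derivative al x <= p * al x.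
Proof.
move=> x0; rewrite -ler_pdivrMr ?young_gt0//.
by apply: ub_le_sup; [case: p_has_sup|exists x].
Qed.

Lemma r_exponent_ge1 : 1 <= r.
Proof.
apply: lb_le_inf; first by case: r_has_inf.
by move=> _ [x x0 <-]; exact: left_ge1.
Qed.

Lemma r_exponent_le_p : r <= p.
Proof.
rewrite -(ler_pM2r (young_gt0 ltr01)).
apply: le_trans (r_le ltr01) (le_trans _ (le_p ltr01)).
by rewrite !mul1r; exact: left_derivative_le_right.
Qed.

Let p_ge0 : 0 <= p.
Proof. by rewrite (le_trans ler01)// (le_trans r_exponent_ge1)// r_exponent_le_p. Qed.

(** In the variable x exp(h) the exponents bound the logarithmic derivative of [al]. This is the
    first-order form, from the supporting line at [x] and exp h - 1 >= h; [ge_1Bp] is its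
    counterpart towards 0. *)
Let ge_1Dr x h : 0 < x -> 0 <= h -> al x * (1 + r * h) <= al (x * expR h).
Proof.
move=> x0; rewrite le_eqVlt => /predU1P[<-|h0].
  by rewrite expR0 mulr0 addr0 !mulr1.
have eh : 1 < expR h by rewrite expR_gt1.
have xe : x < x * expR h by rewrite ltr_pMr.
have H1 := right_derivative_le A xe.
have H2 := left_derivative_le_right A x.
have H3 := r_le x0.
have eh1 := expR_ge1Dx h.
have : r * al x * h <= r * al x * (expR h - 1).
  apply: ler_wpM2l; last lra.
  by rewrite mulr_ge0 ?(cost_ge0 A)//; exact: le_trans r_exponent_ge1.
have : r * al x * (expR h - 1) <= x * right_derivative al x * (expR h - 1).
  apply: ler_wpM2r; first lra.
  by apply: (le_trans H3); rewrite ler_pM2l.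
have -> : x * right_derivative al x * (expR h - 1) =
  right_derivative al x * (x * expR h - x) by ring.
lra.
Qed.

Let ge_1Bp x h : 0 < x -> 0 <= h -> al x * (1 - p * h) <= al (x * expR (- h)).
Proof.
move=> x0; rewrite le_eqVlt => /predU1P[<-|h0].
  by rewrite oppr0 expR0 mulr0 subr0 !mulr1.
have eh : expR (- h) < 1 by rewrite expR_lt1; lra.
have e0 := expR_gt0 (- h).
have xe : x * expR (- h) < x by rewrite gtr_pMr.
have H1 := left_derivative_ge A xe.
have H2 := left_derivative_le_right A x.
have H3 := le_p x0.
have eh1 := expR_ge1Dx (- h).
have : p * al x * (1 - expR (- h)) <= p * al x * h.
  by apply: ler_wpM2l; [rewrite mulr_ge0 ?(cost_ge0 A)|lra].
have : x * left_derivative al x * (1 - expR (- h)) <= p * al x * (1 - expR (- h)).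
  apply: ler_wpM2r; first lra.
  by apply: le_trans H3; rewrite ler_pM2l.
have -> : x * left_derivative al x * (1 - expR (- h)) =
  left_derivative al x * (x - x * expR (- h)) by ring.
lra.
Qed.

(** Integrates [ge_1Bp] in logarithmic scale: t |-> p t + ln al(x exp(-t)) is nondecreasing up to
    quadratic errors, and t = - ln s gives the claim. Together with [young_scale_ge1] it carries the
    exponents into the flow. *)
Lemma young_scale_le1 s x : 0 < s -> s <= 1 -> 0 <= x -> s `^ p * al x <= al (s * x).
Proof.
move=> s0 s1; rewrite le_eqVlt => /predU1P[<-|x0].
  by rewrite !mulr0 (young0 Y) mulr0.
pose g t := - (p * t) - ln (al (x * expR (- t))).
have xe t : 0 < x * expR t by rewrite mulr_gt0// expR_gt0.
have p0 := p_ge0.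
have : g (- ln s) <= g 0.
  apply: (@quadratic_error_nonincreasing _ _ (2 * p ^+ 2)).
    by rewrite oppr_ge0 ln_le0.
  have P0 : 0 < 1 + p by lra.
  (* This step size keeps p h <= 1/2, where ln(1 - y) >= - y - 2 y^2 holds for y = p h. *)
  exists (2 * (1 + p))^-1; first by rewrite invr_gt0; lra.
  move=> t h t0 h0 hh _; rewrite /g.
  have ph : p * h <= 2^-1.
    have : h * (2 * (1 + p)) <= 1.
      by rewrite -ler_pdivlMr; lra.
    have : 0 <= p * h by rewrite mulr_ge0 ?p_ge0// ltW.
    lra.
  have ph0 : 0 <= p * h by rewrite mulr_ge0 ?p_ge0// ltW.
  have l0 : 0 < 1 - p * h by lra.
  have := ge_1Bp (xe (- t)) (ltW h0).
  have -> : x * expR (- t) * expR (- h) = x * expR (- (t + h)).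
    by rewrite opprD expRD mulrA.
  have a0 := young_gt0 (xe (- t)); have a1 := young_gt0 (xe (- (t + h))).
  rewrite -ler_ln ?posrE ?mulr_gt0// lnM ?posrE// => H.
  suff : - (p * h) - 2 * (p * h) ^+ 2 <= ln (1 - p * h).
    by rewrite exprMn; lra.
  have : ln ((1 - p * h)^-1) <= (1 - p * h)^-1 - 1.
    have := @le_ln1Dx _ ((1 - p * h)^-1 - 1).
    rewrite addrCA subrr addr0; apply.
    have : 0 < (1 - p * h)^-1 by rewrite invr_gt0.
    lra.
  rewrite lnV ?posrE//.
  suff : (1 - p * h)^-1 - 1 <= p * h + 2 * (p * h) ^+ 2 by lra.
  rewrite -(ler_pM2r l0) mulrBl mulVf ?gt_eqF//.
  have : 0 <= (p * h) ^+ 2 * (1 - 2 * (p * h)) by rewrite mulr_ge0 ?sqr_ge0//; lra.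
  have -> : (p * h + 2 * (p * h) ^+ 2) * (1 - p * h) =
    p * h + (p * h) ^+ 2 * (1 - 2 * (p * h)) by ring.
  lra.
rewrite /g oppr0 mulr0 expR0 opprK mulr1 oppr0 sub0r lnK ?posrE// => H.
have sx : 0 < x * s by rewrite mulr_gt0.
have a0 := young_gt0 x0; have a1 := young_gt0 sx.
rewrite [s * x]mulrC -ler_ln ?posrE// ?mulr_gt0 ?powR_gt0// lnM ?posrE ?powR_gt0//.
rewrite ln_powR; lra.
Qed.

Lemma young_scale_ge1 s x : 1 <= s -> 0 <= x -> s `^ r * al x <= al (s * x).
Proof.
move=> s1; rewrite le_eqVlt => /predU1P[<-|x0].
  by rewrite !mulr0 (young0 Y) mulr0.
have s0 : 0 < s by lra.
pose g t := r * t - ln (al (x * expR t)).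
have xe t : 0 < x * expR t by rewrite mulr_gt0// expR_gt0.
have : g (ln s) <= g 0.
  apply: (@quadratic_error_nonincreasing _ _ (r ^+ 2)).
    by rewrite ln_ge0.
  exists 1 => // t h t0 h0 hh _; rewrite /g.
  have rh0 : 0 <= r * h.
    by rewrite mulr_ge0 ?(ltW h0)//; exact: le_trans r_exponent_ge1.
  have := ge_1Dr (xe t) (ltW h0).
  have -> : x * expR t * expR h = x * expR (t + h) by rewrite expRD mulrA.
  have a0 := young_gt0 (xe t); have a1 := young_gt0 (xe (t + h)).
  have l0 : 0 < 1 + r * h by lra.
  rewrite -ler_ln ?posrE ?mulr_gt0// lnM ?posrE// => H.
  suff : r * h - (r * h) ^+ 2 <= ln (1 + r * h).
    by rewrite exprMn; lra.
  have : ln ((1 + r * h)^-1) <= (1 + r * h)^-1 - 1.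
    have := @le_ln1Dx _ ((1 + r * h)^-1 - 1).
    rewrite addrCA subrr addr0; apply.
    have : 0 < (1 + r * h)^-1 by rewrite invr_gt0.
    lra.
  rewrite lnV ?posrE//.
  suff : (1 + r * h)^-1 - 1 <= (r * h) ^+ 2 - r * h by lra.
  rewrite -(ler_pM2r l0) mulrBl mulVf ?gt_eqF//.
  have : 0 <= (r * h) ^+ 2 * (r * h) by rewrite mulr_ge0 ?sqr_ge0.
  have -> : ((r * h) ^+ 2 - r * h) * (1 + r * h) =
    (r * h) ^+ 2 * (r * h) - r * h by ring.
  lra.
rewrite /g mulr0 expR0 mulr1 sub0r lnK ?posrE// => H.
have sx : 0 < x * s by rewrite mulr_gt0.
have a0 := young_gt0 x0; have a1 := young_gt0 sx.
rewrite [s * x]mulrC -ler_ln ?posrE// ?mulr_gt0 ?powR_gt0// lnM ?posrE ?powR_gt0//.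
rewrite ln_powR; lra.
Qed.

(** If p <= 1, then s^p >= s on (0, 1], so [al s >= s * al 1] there: the difference quotients at 0
    stay above [al 1 > 0], against the vanishing derivative. *)
Lemma p_exponent_gt1 : 1 < p.
Proof.
rewrite ltNge; apply/negP => p1.
have lin s : 0 < s -> s <= 1 -> s * al 1 <= al s.
  move=> s0 s1; have := young_scale_le1 s0 s1 ler01; rewrite mulr1.
  apply: le_trans; apply: ler_wpM2r; first exact: (cost_ge0 A).
  by rewrite -[leLHS]powRr1 ?(ltW s0)//; apply: ger_powR => //; rewrite s0.
have [dal al0] := young_derive0 Y.
suff : al 1 <= 0 by rewrite leNgt (cost_gt0 A).
rewrite -al0.
have H : (fun h => h^-1 *: ((al \o shift 0) (h *: 1) - al 0)) @ 0^'+ --> 'D_1 al 0.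
  exact: cvg_dnbhs_at_right.
rewrite -(cvg_lim _ H)//; apply: limr_ge; first by apply/cvg_ex; eexists; exact: H.
near=> h.
have h0 : 0 < h by near: h; exact: nbhs_right_gt.
have h1 : h <= 1 by near: h; apply: nbhs_right_le.
rewrite /= (young0 Y) subr0 addr0 /GRing.scale/= mulr1 mulrC ler_pdivlMr// mulrC lin//.
Unshelve. all: by end_near. Qed.

End exponents.

(** * Regularization of the cost *)

Section smoothing.
Context {R : realType}.
Variable al : R -> R.
Hypothesis A : convex_cost al.
Notation leb := (@lebesgue_measure R).

(* Averaging over scales preserves both power-type scaling inequalities of al,
   and makes t * al (u / t) semiconcave in the time t. *)
Definition smooth_cost (k u : R) : R :=
  (k - 1)^-1 * \int[leb]_(s in `[1, k]) al (`|u| / s).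

Let cost_abs_continuous : continuous (fun x : R => al `|x| : R).
Proof.
move=> x; apply/cvgrPdist_lt => e e0.
pose L := al (`|x| + 1 + 1).
have L0 : 0 <= L := cost_ge0 A _.
have d0 : 0 < e / (L + 1) by rewrite divr_gt0//; lra.
have near_x (d : R) : 0 < d -> \forall y \near x, `|x - y| < d.
  exact: nbhsx_ballx.
apply: filterS2 (near_x _ ltr01) (near_x _ d0) => y xy1 xy2.
have d1 : `| `|x| - `|y| | <= `|x - y| := ler_dist_dist _ _.
apply: (@le_lt_trans _ _ (`|x - y| * L)); last first.
  have : `|x - y| * (L + 1) < e by rewrite -ltr_pdivlMr//; lra.
  by have := normr_ge0 (x - y); lra.
apply: le_trans (_ : `| `|x| - `|y| | * L <= _); last exact: ler_wpM2r.
have lip a b : 0 <= a -> a <= b -> b <= `|x| + 1 -> `|al a - al b| <= `|a - b| * L.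
  move=> a0 ab bB; rewrite distrC [X in _ <= X * _]distrC.
  rewrite !ger0_norm ?subr_ge0 ?(cost_mono A)//.
  exact: (cost_lip A).
have [xy|yx] := leP `|x| `|y|.
  by apply: lip => //; move: d1; rewrite ler_norml => /andP[]; lra.
by rewrite distrC [X in _ <= X * _]distrC; apply: lip => //; lra.
Qed.

Let scale_continuous (u a b : R) : 0 < a ->
  {within `[a, b], continuous (fun s => al (`|u| / s))}.
Proof.
move=> a0; apply: (@subspace_eq_continuous _ _ _ ((fun x : R => al `|x|) \o (fun s => u / s))).
  move=> s; rewrite inE/= in_itv/= => /andP[as_ _].
  by rewrite /= normrM normfV (ger0_norm (le_trans (ltW a0) as_)).
apply: continuous_in_subspaceT => s; rewrite inE/= in_itv/= => /andP[as_ _].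
apply: continuous_comp; last exact: cost_abs_continuous.
by apply: cvgM; [exact: cvg_cst|apply: cvgV => //; rewrite gt_eqF//; lra].
Qed.

Let scale_integrable (u a b : R) : 0 < a ->
  leb.-integrable `[a, b] (EFin \o (fun s => al (`|u| / s))).
Proof.
move=> a0; apply: continuous_compact_integrable; first exact: segment_compact.
exact: scale_continuous.
Qed.

Let scaleZ_integrable (c u a b : R) : 0 < a ->
  leb.-integrable `[a, b] (EFin \o (fun s => c * al (`|u| / s))).
Proof.
move=> a0; under [EFin \o _]eq_fun do rewrite /= EFinM.
by apply: integrableZl => //; exact: scale_integrable.
Qed.

Let scale_int (u a b : R) : R := \int[leb]_(s in `[a, b]) al (`|u| / s).

Let int_cst (c a b : R) : a <= b -> \int[leb]_(s in `[a, b]) c = (b - a) * c.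
Proof.
move=> ab; rewrite Rintegral_cst//= lebesgue_measure_itv/= lte_fin.
case: ltP => h /=; first by rewrite mulrC.
have -> : b = a by lra.
by rewrite subrr mul0r mulr0.
Qed.

Let scale_int_ge (u a b : R) : 0 < a -> a <= b ->
  (b - a) * al (`|u| / b) <= scale_int u a b.
Proof.
move=> a0 ab; have b0 : 0 < b by lra.
have -> : (b - a) * al (`|u| / b) = \int[leb]_(s in `[a, b]) (al (`|u| / b)).
  by rewrite int_cst.
apply: le_Rintegral => //; first by apply: continuous_compact_integrable;
  [exact: segment_compact|exact: continuous_subspaceT (@cst_continuous _ _ _)].
  exact: scale_integrable.
move=> s /=; rewrite in_itv/= => /andP[as_ sb]; apply: (cost_mono A).
  by rewrite divr_ge0// ltW.
by apply: ler_wpM2l => //; rewrite lef_pV2// posrE; lra.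
Qed.

Let scale_int_le (u a b : R) : 0 < a -> a <= b ->
  scale_int u a b <= (b - a) * al (`|u| / a).
Proof.
move=> a0 ab; have b0 : 0 < b by lra.
have -> : (b - a) * al (`|u| / a) = \int[leb]_(s in `[a, b]) (al (`|u| / a)).
  by rewrite int_cst.
apply: le_Rintegral => //; first exact: scale_integrable.
  by apply: continuous_compact_integrable;
    [exact: segment_compact|exact: continuous_subspaceT (@cst_continuous _ _ _)].
move=> s /=; rewrite in_itv/= => /andP[as_ sb]; apply: (cost_mono A).
  by rewrite divr_ge0//; lra.
by apply: ler_wpM2l => //; rewrite lef_pV2// posrE; lra.
Qed.

Let scale_intD (u a b c : R) : 0 < a -> a <= b -> b <= c ->
  scale_int u a c = scale_int u a b + scale_int u b c.
Proof.
move=> a0 ab bc; rewrite /scale_int.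
have := @Rintegral_itvB _ (fun s => al (`|u| / s)) (BLeft a) (BRight c) b.
rewrite !bnd_simp => /(_ (scale_integrable _ _ a0) ab bc).
rewrite Rintegral_itv_obnd_cbnd; first lra.
apply: integrableS (@scale_integrable u a c a0) => //.
by apply: subset_itvr; rewrite bnd_simp.
Qed.

(** Moves the time from the integrand to the endpoints: the perspective of the average becomes the
    integral of a fixed function over an interval that slides with [t]. *)
Let scale_int_subst (u t a b : R) : 0 < t -> 0 < a -> a <= b ->
  scale_int u (t * a) (t * b) = t * scale_int (u / t) a b.
Proof.
move=> t0 a0 ab; rewrite /scale_int -RintegralZl//; last exact: scale_integrable.
rewrite /Rintegral; congr fine.
have dF x : derive1 (fun s : R => t * s) x = t.
  by rewrite derive1E deriveZ//= derive_id /GRing.scale/= mulr1.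
have dFE : derive1 (fun s : R => t * s) = fun=> t by apply/funext.
have ct : continuous (fun s : R => t * s) by move=> x; apply: cvgM; [exact: cvg_cst|].
rewrite (@integration_by_substitution_increasing _ (fun s => t * s) (fun s => al (`|u| / s)))//.
- apply: eq_integral => s _; rewrite fctE/= dF; congr EFin.
  by rewrite mulrC normrM normfV (gtr0_norm t0) invfM mulrA.
- by move=> x y _ _; rewrite ltr_pM2l.
- by rewrite dFE => x _; exact: cvg_cst.
- by rewrite dFE; exact: is_cvg_cst.
- by rewrite dFE; exact: is_cvg_cst.
- split; first by move=> x _; exact: derivableZ.
  + exact/cvg_at_right_filter/ct.
  + exact/cvg_at_left_filter/ct.
- by apply: scale_continuous; rewrite mulr_gt0.
Qed.

Variable k : R.
Hypothesis k1 : 1 < k.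
Let k10 : 0 < k - 1. Proof. by rewrite subr_gt0. Qed.

Lemma smooth_cost_le u : 0 <= u -> smooth_cost k u <= al u.
Proof.
move=> u0; rewrite /smooth_cost mulrC ler_pdivrMr// mulrC.
by rewrite -[X in al X](ger0_norm u0) -[X in al X]divr1; exact: scale_int_le ltr01 (ltW k1).
Qed.

Lemma smooth_cost_ge u : 0 <= u -> al (u / k) <= smooth_cost k u.
Proof.
move=> u0; rewrite /smooth_cost [leRHS]mulrC ler_pdivlMr// [leLHS]mulrC.
by rewrite -[X in al (X / k)](ger0_norm u0); exact: scale_int_ge ltr01 (ltW k1).
Qed.

Lemma smooth_cost_even u : smooth_cost k (- u) = smooth_cost k u.
Proof. by rewrite /smooth_cost normrN. Qed.

Lemma smooth_cost_convex_cost : (forall x, 0 < x -> 0 < al x) ->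
  convex_cost (smooth_cost k).
Proof.
move=> apos; split.
- move=> x; apply: mulr_ge0; first by rewrite invr_ge0 ltW.
  by apply: Rintegral_ge0 => s _; exact: (cost_ge0 A).
- rewrite /smooth_cost normr0; under eq_Rintegral do rewrite mul0r (cost0 A).
  by rewrite Rintegral_cst//= mul0r mulr0.
- apply: lt_le_trans (smooth_cost_ge ler01); apply: apos.
  by rewrite divr_gt0// (lt_trans ltr01 k1).
- move=> x y x0 xy; rewrite ler_pM2l ?invr_gt0//; apply: le_Rintegral => //.
  + exact: scale_integrable.
  + exact: scale_integrable.
  + move=> s /=; rewrite in_itv/= => /andP[s1 _]; have s0 : 0 < s by lra.
    apply: (cost_mono A); first by rewrite divr_ge0// ltW.
    by rewrite ler_pM2r ?invr_gt0// !ger0_norm//; lra.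
- move=> t x y t0 t1.
  have -> : t * smooth_cost k x + (1 - t) * smooth_cost k y =
    (k - 1)^-1 * \int[leb]_(s in `[1, k]) (t * al (`|x| / s) + (1 - t) * al (`|y| / s)).
    rewrite RintegralD//.
    + rewrite !RintegralZl//; [|exact: scale_integrable..].
      by rewrite /smooth_cost; ring.
    + exact: scaleZ_integrable.
    + exact: scaleZ_integrable.
  rewrite ler_pM2l ?invr_gt0//; apply: le_Rintegral => //.
  + exact: scale_integrable.
  + under [EFin \o _]eq_fun do rewrite /= EFinD.
    by apply: integrableD => //; exact: scaleZ_integrable.
  + move=> s /=; rewrite in_itv/= => /andP[s1 _]; have s0 : 0 < s by lra.
    apply: le_trans (cost_conv A _ _ t0 t1).
    apply: (cost_mono A); first by rewrite divr_ge0// ltW.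
    rewrite !mulrA -mulrDl ler_pM2r ?invr_gt0//.
    apply: le_trans (ler_normD _ _) _.
    by rewrite !normrM (ger0_norm t0) (@ger0_norm _ (1 - t))//; lra.
Qed.

Lemma smooth_cost_scale (m c u : R) : 0 <= m -> 0 <= u ->
  (forall x, 0 <= x -> c * al x <= al (m * x)) ->
  c * smooth_cost k u <= smooth_cost k (m * u).
Proof.
move=> m0 u0 H; rewrite /smooth_cost mulrCA ler_pM2l ?invr_gt0//.
rewrite -RintegralZl//; last exact: scale_integrable.
apply: le_Rintegral => //.
- exact: scaleZ_integrable.
- exact: scale_integrable.
- move=> s /=; rewrite in_itv/= => /andP[s1 _]; have s0 : 0 < s by lra.
  rewrite normrM (ger0_norm m0) -mulrA; apply: H.
  by rewrite divr_ge0// ltW.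
Qed.

Let perspectiveE (D t : R) : 0 < t ->
  t * smooth_cost k (D / t) = (k - 1)^-1 * scale_int D t (k * t).
Proof.
move=> t0; rewrite /smooth_cost mulrCA; congr (_ * _).
by rewrite -scale_int_subst// ?(ltW k1)// mulr1 [t * k]mulrC.
Qed.

(** For a general [al], t al(D / t) is convex in t, and a kink of [al] destroys semiconcavity. After
    averaging, the slope in t involves only values of [al], not its derivative, and these values are
    Lipschitz in time. *)
Lemma smooth_cost_semiconcave : semiconcave_cost (smooth_cost k).
Proof.
move=> a Dm a0 Dm0.
(* Lipschitz constant of s |-> al(D / s) on [a, +oo): Dm / a^2 for s |-> D / s, times the constant
   of [cost_lip] on [0, Dm / a]. *)
pose L0 := Dm / a ^+ 2 * al (Dm / a + 1).
have L00 : 0 <= L0 by rewrite mulr_ge0 ?(cost_ge0 A)// divr_ge0// ?sqr_ge0.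
have lip D t t' : 0 <= D -> D <= Dm -> a <= t -> t <= t' ->
    al (D / t) - al (D / t') <= L0 * (t' - t).
  move=> D0 DDm at_ tt'; have [p p'] : 0 < t /\ 0 < t' by lra.
  apply: le_trans (@cost_lip _ _ A (Dm / a) _ _ _ _ _) _.
  - by rewrite divr_ge0// ltW.
  - by apply: ler_wpM2l => //; rewrite lef_pV2.
  - apply: ler_pM => //; first by rewrite invr_ge0 ltW.
    by rewrite lef_pV2.
  rewrite /L0 mulrAC; apply: ler_wpM2r; first exact: (cost_ge0 A).
  have -> : D / t - D / t' = D / (t * t') * (t' - t) by field; rewrite !gt_eqF.
  apply: ler_wpM2r; first lra.
  apply: ler_pM => //; first by rewrite invr_ge0 mulr_ge0// ltW.
  rewrite lef_pV2 ?posrE ?mulr_gt0 ?exprn_gt0// expr2.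
  by apply: ler_pM; lra.
clearbody L0; exists ((k - 1)^-1 * L0); first by rewrite mulr_ge0// invr_ge0 ltW.
move=> D t0 t1 t2 D0 DDm at0 t01 t12.
have [p0 [p1 p2]] : 0 < t0 /\ 0 < t1 /\ 0 < t2 by lra.
have kk : 0 < k := lt_trans ltr01 k1.
have lek1 := ltW k1.
rewrite !perspectiveE//.
(* t * al~ (D / t) is a constant times the integral over [t, k t]; increments
   of it are differences of integrals over two short intervals *)
have inc s t : a <= s -> s < t ->
    scale_int D t (k * t) - scale_int D s (k * s) =
    scale_int D (k * s) (k * t) - scale_int D s t.
  move=> as_ st; have s0 : 0 < s by lra.
  have ks : s <= k * s by rewrite ler_peMl// ltW.
  have kt : t <= k * t by rewrite ler_peMl//; lra.
  have kst : k * s <= k * t by rewrite ler_pM2l// ltW.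
  have := scale_intD D s0 ks kst; have := scale_intD D s0 (ltW st) kt.
  lra.
have k01 : k * t0 <= k * t1 by rewrite ler_pM2l// ltW.
have k12 : k * t1 <= k * t2 by rewrite ler_pM2l// ltW.
have kt0 : 0 < k * t0 by rewrite mulr_gt0.
have kt1 : 0 < k * t1 by rewrite mulr_gt0.
have := inc _ _ at0 t01; have := inc t1 t2 ltac:(lra) t12.
(* The two outer intervals share the endpoint k t1, and both are compared with the value of the
   integrand there, which therefore cancels. Only al(D / t0) - al(D / t2) remains, and [lip] bounds
   it. *)
have := scale_int_ge D kt0 k01; have := scale_int_le D kt1 k12.
have := scale_int_ge D p1 (ltW t12); have := scale_int_le D p0 (ltW t01).
rewrite -!mulrBr (ger0_norm D0).
have := lip D t0 t2 D0 DDm at0 ltac:(lra).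
set J0 := scale_int D t0 t1; set J1 := scale_int D t1 t2.
set I0 := scale_int D t0 _; set I1 := scale_int D t1 _; set I2 := scale_int D t2 _.
set K0 := scale_int D (k * t0) _; set K1 := scale_int D (k * t1) _.
set x := al (D / t0); set y := al (D / (k * t1)); set z := al (D / t2).
move=> h0 h1 h2 h3 h4 h5 h6.
rewrite -!mulrA !(mulrCA _ (k - 1)^-1) -mulrDr ler_pM2l ?invr_gt0//.
have u1 : 0 < t1 - t0 by lra.
have u2 : 0 < t2 - t1 by lra.
have e6 : I0 - I1 <= (t1 - t0) * x - k * (t1 - t0) * y by lra.
have e5 : (t2 - t1) * z - k * (t2 - t1) * y <= I1 - I2 by lra.
have f6 := ler_wpM2l (ltW u2) e6.
have f5 := ler_wpM2l (ltW u1) e5.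
have g := ler_wpM2l (ltW (mulr_gt0 u1 u2)) h0.
lra.
Qed.

End smoothing.

(** * Integrals of bounded functions *)

Section bounded_measurable.
Context {d : measure_display} {T : measurableType d} {R : realType}.
Implicit Types (g h : T -> R).

Definition bounded_measurable g :=
  measurable_fun setT g /\ exists c, forall x, `|g x| <= c.

Lemma bounded_measurable_cst (c : R) : bounded_measurable (fun=> c).
Proof. by split; [exact: measurable_cst|exists `|c|]. Qed.

Lemma bounded_measurableD g h : bounded_measurable g -> bounded_measurable h ->
  bounded_measurable (fun x => g x + h x).
Proof.
move=> [mg [c gc]] [mh [e he]]; split; first exact: measurable_funD.
by exists (c + e) => x; apply: le_trans (ler_normD _ _) _; apply: lerD.
Qed.

Lemma bounded_measurableM g h : bounded_measurable g -> bounded_measurable h ->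
  bounded_measurable (fun x => g x * h x).
Proof.
move=> [mg [c gc]] [mh [e he]]; split; first exact: measurable_funM.
by exists (c * e) => x; rewrite normrM ler_pM.
Qed.

Lemma bounded_measurableZ (c : R) g : bounded_measurable g ->
  bounded_measurable (fun x => c * g x).
Proof. by move=> bg; exact: bounded_measurableM (bounded_measurable_cst c) bg. Qed.

Lemma bounded_measurable_expR g : bounded_measurable g ->
  bounded_measurable (fun x => expR (g x)).
Proof.
move=> [mg [c gc]]; split; first exact: measurableT_comp.
exists (expR c) => x; rewrite ger0_norm ?expR_ge0// ler_expR.
exact: le_trans (ler_norm _) (gc x).
Qed.

Lemma bounded_measurable_bounded_fun g : bounded_measurable g -> bounded_fun g.
Proof.
move=> [_ [c gc]]; exists c; split; first exact: num_real.
by move=> y cy x _; exact: le_trans (gc x) (ltW cy).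
Qed.

Variable mu : probability T R.

Lemma bounded_measurable_integrable g : bounded_measurable g ->
  mu.-integrable setT (EFin \o g).
Proof.
move=> bg; apply: measurable_bounded_integrable => //.
- by rewrite fin_num_fun_lty//; exact: fin_num_measure.
- by case: bg.
- exact: bounded_measurable_bounded_fun.
Qed.

Lemma bm_RintegralD g h : bounded_measurable g -> bounded_measurable h ->
  \int[mu]_x (g x + h x) = \int[mu]_x g x + \int[mu]_x h x.
Proof. by move=> bg bh; rewrite RintegralD//; exact: bounded_measurable_integrable. Qed.

Lemma bm_RintegralZ (c : R) g : bounded_measurable g ->
  \int[mu]_x (c * g x) = c * \int[mu]_x g x.
Proof. by move=> bg; rewrite RintegralZl//; exact: bounded_measurable_integrable. Qed.

Lemma bm_le_Rintegral g h : bounded_measurable g -> bounded_measurable h ->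
  (forall x, g x <= h x) -> \int[mu]_x g x <= \int[mu]_x h x.
Proof. by move=> bg bh gh; apply: le_Rintegral => //; exact: bounded_measurable_integrable. Qed.

Lemma Rintegral_probability_cst (c : R) : \int[mu]_x c = c.
Proof. by rewrite Rintegral_cst// [X in fine X]probability_setT/= mulr1. Qed.

Lemma Rintegral_EFin g : bounded_measurable g ->
  (\int[mu]_x (g x)%:E = (\int[mu]_x g x)%R%:E)%E.
Proof.
move=> bg; rewrite /Rintegral fineK//; apply: integrable_fin_num => //.
exact: bounded_measurable_integrable.
Qed.

Lemma Rintegral_expR_gt0 g : bounded_measurable g -> 0 < \int[mu]_x expR (g x).
Proof.
move=> bg; have [_ [c gc]] := bg; apply: (@lt_le_trans _ _ (expR (- c))).
  exact: expR_gt0.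
rewrite -[leLHS]Rintegral_probability_cst; apply: bm_le_Rintegral.
- exact: bounded_measurable_cst.
- exact: bounded_measurable_expR.
- by move=> x; rewrite ler_expR; have := gc x; rewrite ler_norml => /andP[].
Qed.

(** Meant for slopes and for the cost on the product space, whose measurability is not established:
    the integral of a nonnegative function is a supremum over the simple functions below it, hence
    monotone. *)
Lemma ge0_le_integral_nonmeasurable (f g : T -> \bar R) : (forall x, (0 <= f x)%E) ->
  (forall x, (f x <= g x)%E) -> (\int[mu]_x f x <= \int[mu]_x g x)%E.
Proof.
move=> f0 fg; have g0 x : (0 <= g x)%E := le_trans (f0 x) (fg x).
rewrite !ge0_integralTE//; apply: ereal_sup_le => _ [h /= hf <-].
by exists h => //= x; exact: le_trans (hf x) (fg x).
Qed.

(** Integrates 1 + u <= exp u, at u = ln Z - g, against exp g. This is the nonnegativity of the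
    entropy of exp g. *)
Lemma jensen_expR g : bounded_measurable g ->
  (\int[mu]_x expR (g x)) * ln (\int[mu]_x expR (g x)) <=
  \int[mu]_x (g x * expR (g x)).
Proof.
move=> bg; have Z0 := Rintegral_expR_gt0 bg; set Z := Rintegral _ _ _ in Z0 *.
have be := bounded_measurable_expR bg.
have bge := bounded_measurableM bg be.
have bz := bounded_measurableZ (- ln Z) be.
have bc := bounded_measurable_cst (- Z).
have H : \int[mu]_x (expR (g x) + (- Z)) <=
    \int[mu]_x (g x * expR (g x) + (- ln Z) * expR (g x)).
  apply: bm_le_Rintegral; [exact: bounded_measurableD|exact: bounded_measurableD|].
  move=> x; have := expR_ge1Dx (- (g x - ln Z)).
  rewrite opprB expRB lnK ?posrE// => /(ler_wpM2r (expR_ge0 (g x))).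
  by rewrite divfK ?gt_eqF ?expR_gt0//; lra.
rewrite !bm_RintegralD// in H.
rewrite Rintegral_probability_cst bm_RintegralZ// in H.
by move: H; rewrite -/Z; lra.
Qed.

End bounded_measurable.

Section scalar_estimates.
Context {R : realType}.

Lemma expR_le_quadratic (y : R) : `|y| <= 2^-1 -> expR y <= 1 + y + 2 * y ^+ 2.
Proof.
rewrite ler_norml => /andP[y1 y2].
have y0 : 0 < 1 - y by lra.
have e1 : 1 - y <= (expR y)^-1 by rewrite -expRN; exact: expR_ge1Dx.
have : expR y <= (1 - y)^-1.
  by rewrite -[leLHS]invrK lef_pV2 ?posrE ?invr_gt0 ?expR_gt0.
move=> /le_trans; apply; rewrite -(ler_pM2r y0) mulVf ?gt_eqF//.
have : 0 <= y ^+ 2 * (1 - 2 * y) by rewrite mulr_ge0 ?sqr_ge0//; lra.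
have -> : (1 + y + 2 * y ^+ 2) * (1 - y) = 1 + y ^+ 2 * (1 - 2 * y) by ring.
lra.
Qed.

(** The convex function s |-> s^(-m) lies above its tangent at [s]. This controls the decrease of
    1/k along the flow, where k = s^m. *)
Lemma powRN_tangent (m s s' : R) : 0 <= m -> 0 < s -> s <= s' ->
  (s `^ m)^-1 - (s' `^ m)^-1 <= m * (s' - s) / s `^ (m + 1).
Proof.
move=> m0 s0 ss'; have s'0 : 0 < s' by lra.
have k0 : 0 < s `^ m := powR_gt0 _ s0.
have x0 : 0 < s' / s by rewrite divr_gt0.
have smE : s `^ (m + 1) = s `^ m * s.
  by rewrite powRD ?powRr1 ?(ltW s0)//; apply/implyP => _; rewrite gt_eqF.
rewrite smE invfM -!powRN.
have -> : s' = s * (s' / s) by rewrite mulrC divfK// gt_eqF.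
rewrite powRM ?(ltW s0) ?(ltW x0)//.
have e1 : 1 - m * (s' / s - 1) <= (s' / s) `^ (- m).
  rewrite -[X in X `^ _]lnK ?posrE// -expRM.
  apply: le_trans (expR_ge1Dx _).
  have := @le_ln1Dx _ (s' / s - 1); rewrite addrCA subrr addr0 => H.
  have := ler_wpM2l m0 (H ltac:(lra)); lra.
have := ler_wpM2l (powR_ge0 s (- m)) e1.
have -> : m * (s * (s' / s) - s) * (s `^ (- m) / s) = s `^ (- m) * (m * (s' / s - 1)).
  by field; rewrite gt_eqF.
lra.
Qed.

Lemma ln_le_subr1 (x : R) : 0 < x -> ln x <= x - 1.
Proof.
by move=> x0; have := @le_ln1Dx _ (x - 1); rewrite addrCA subrr addr0; apply; lra.
Qed.

(** One time step of the flow: Z and Z' are the exponential integrals before and after, I and W the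
    integrals of Q_t f and of its time slope against exp(k Q_t f). To first order ln Z / k changes
    by (1/k - 1/k') times entropy / Z, minus h W / Z; the bound h / (A S) on the first factor lets
    the logarithmic Sobolev inequality absorb the entropy. *)
Lemma ln_mean_step (Z Z' I W k k' kmin h A S N : R) : 0 < Z -> 0 < Z' ->
  0 < kmin -> kmin <= k -> k <= k' -> 0 <= h -> 0 < A -> 0 < S -> 0 <= N ->
  k^-1 - k'^-1 <= h / (A * S) ->
  0 <= k * I - Z * ln Z -> k * I - Z * ln Z <= A * (S * W) ->
  Z' <= Z + (k' - k) * I - k' * h * W + N * h ^+ 2 * Z ->
  ln Z' / k' <= ln Z / k + N / kmin * h ^+ 2.
Proof.
move=> Z0 Z'0 kmin0 kmink kk' h0 A0 S0 N0 rhoh ent0 ent ineq.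
have k0 : 0 < k by lra.
have k'0 : 0 < k' by lra.
have lnZ' : ln Z' <= ln Z + (Z' / Z - 1).
  by rewrite -lerBlDl -ln_div ?posrE//; exact: ln_le_subr1 (divr_gt0 Z'0 Z0).
pose io := I / Z; pose om := W / Z; pose l := ln Z.
have ZZ : Z' / Z - 1 <= (k' - k) * io - k' * h * om + N * h ^+ 2.
  rewrite -(ler_pM2r Z0) mulrBl divfK ?gt_eqF//.
  have -> : ((k' - k) * io - k' * h * om + N * h ^+ 2) * Z =
    (k' - k) * I - k' * h * W + N * h ^+ 2 * Z.
    by rewrite /io /om; field; rewrite gt_eqF.
  lra.
have entE : k * io - l = (k * I - Z * ln Z) / Z.
  by rewrite /io /l; field; rewrite gt_eqF.
have e1 : k * io - l <= A * S * om.
  by rewrite entE /om [leRHS]mulrA ler_pM2r ?invr_gt0// -mulrA.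
have e0 : 0 <= k * io - l by rewrite entE divr_ge0// ltW.
have Nk : N * h ^+ 2 / k' <= N / kmin * h ^+ 2.
  rewrite mulrAC; apply: ler_wpM2r; first exact: sqr_ge0.
  by apply: ler_wpM2l => //; rewrite lef_pV2// ?posrE; lra.
apply: (@le_trans _ _ ((l + ((k' - k) * io - k' * h * om + N * h ^+ 2)) / k')).
  by rewrite ler_pM2r ?invr_gt0// (le_trans lnZ')// lerD2l.
have -> : (l + ((k' - k) * io - k' * h * om + N * h ^+ 2)) / k' =
  l / k + ((k^-1 - k'^-1) * (k * io - l) - h * om) + N * h ^+ 2 / k'.
  by field; rewrite !gt_eqF.
have : (k^-1 - k'^-1) * (k * io - l) <= h * om.
  apply: le_trans (ler_wpM2r e0 rhoh) _.
  rewrite mulrAC ler_pdivrMr ?mulr_gt0// -mulrA; apply: ler_wpM2l => //.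
  by rewrite [leRHS]mulrC.
rewrite -/l; lra.
Qed.

End scalar_estimates.

(** * The Hopf-Lax semigroup *)

Section hopf_lax.
Context {R : realType} {X : metricType R}.
Variable al : R -> R.
Hypothesis A : convex_cost al.
Implicit Types (t h : R) (x y z : X).

Definition hopf_lax (f : X -> R) t x :=
  inf [set f z + t * al (mdist x z / t) | z in [set: X]].

Variables (f : X -> R) (b : R).
Hypothesis fb : forall x, `|f x| <= b.
Local Notation Q := (hopf_lax f).

Let b_ge0 x : 0 <= b. Proof. exact: le_trans (fb x). Qed.

Let cost_t_ge0 t x y : 0 < t -> 0 <= t * al (mdist x y / t).
Proof. by move=> t0; rewrite mulr_ge0 ?(ltW t0)//; exact: (cost_ge0 A). Qed.

Let Q_has_inf t x : 0 < t ->
  has_inf [set f z + t * al (mdist x z / t) | z in [set: X]].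
Proof.
move=> t0; split; first by exists (f x + t * al (mdist x x / t)), x.
exists (- b) => _ [z _ <-]; have := cost_t_ge0 x z t0.
by have := fb z; rewrite ler_norml => /andP[]; lra.
Qed.

Lemma hopf_lax_le t x z : 0 < t -> Q t x <= f z + t * al (mdist x z / t).
Proof.
by move=> t0; apply: ge_inf; [case: (Q_has_inf x t0)|exists z].
Qed.

Lemma hopf_lax_le_fun t x : 0 < t -> Q t x <= f x.
Proof.
move=> t0; apply: le_trans (hopf_lax_le x x t0) _.
by rewrite mdistxx mul0r (cost0 A) mulr0 addr0.
Qed.

Lemma hopf_lax_bounded t x : 0 < t -> `|Q t x| <= b.
Proof.
move=> t0; rewrite ler_norml; apply/andP; split.
  apply: lb_le_inf; first by case: (Q_has_inf x t0).
  move=> _ [z _ <-]; have := cost_t_ge0 x z t0.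
  by have := fb z; rewrite ler_norml => /andP[]; lra.
apply: le_trans (hopf_lax_le_fun x t0) _.
by have := fb x; rewrite ler_norml => /andP[].
Qed.

(** Bounds the distance D to a near-minimizer: for D > t convexity gives t al(D / t) >= D al(1),
    while near-minimality within 1 allows a penalty of at most 2 b + 1. *)
Let radius (T : R) := T + (2 * b + 1) / al 1.

Let hopf_lax_near T t x e : 0 < t -> t <= T -> 0 < e -> e <= 1 ->
  exists2 z, f z + t * al (mdist x z / t) < Q t x + e & mdist x z <= radius T.
Proof.
move=> t0 tT e0 e1; have [_ [z _ <-] Hz] := inf_adherent e0 (Q_has_inf x t0).
exists z => //; have D0 : 0 <= mdist x z := mdist_ge0 _ _.
have al1 := cost_gt0 A.
have R0 : 0 <= (2 * b + 1) / al 1.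
  by have := b_ge0 x; move=> b0; rewrite divr_ge0// ?ltW//; lra.
have [dt|td] := leP (mdist x z) t; first by rewrite /radius; lra.
have D1 : 0 < mdist x z := lt_trans t0 td.
suff : mdist x z <= (2 * b + 1) / al 1 by rewrite /radius; lra.
rewrite ler_pdivlMr//.
have := @cost_scale _ _ A (t / mdist x z) (mdist x z / t).
have -> : t / mdist x z * (mdist x z / t) = 1 by field; rewrite !gt_eqF.
have s1 : t / mdist x z <= 1 by rewrite ler_pdivrMr// mul1r ltW.
move=> /(_ (divr_ge0 (ltW t0) D0) s1)/(ler_wpM2l D0).
rewrite mulrA [_ * (t / _)]mulrC divfK ?gt_eqF// => /le_trans; apply.
have := fb z; have := hopf_lax_bounded x t0.
by rewrite !ler_norml => /andP[? ?] /andP[? ?]; lra.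
Qed.

Lemma hopf_lax_semigroup t h x y : 0 < t -> 0 < h ->
  Q (t + h) x <= Q t y + h * al (mdist x y / h).
Proof.
move=> t0 h0; have th0 : 0 < t + h by rewrite addr_gt0.
rewrite -lerBlDr; apply: lb_le_inf; first by case: (Q_has_inf y t0).
move=> _ [z _ <-]; rewrite lerBlDr; apply: le_trans (hopf_lax_le x z th0) _.
rewrite -addrA lerD2l [leRHS]addrC.
apply: le_trans (_ : (h + t) * al ((mdist x y + mdist y z) / (h + t)) <= _).
  rewrite [h + t]addrC ler_pM2l//; apply: (cost_mono A).
    by rewrite divr_ge0 ?mdist_ge0// ltW.
  by rewrite ler_pM2r ?invr_gt0//; exact: metric_triangle.
exact: (cost_perspective A _ _ h0 t0).
Qed.

(** A near-minimizer at [y] competes at [x], and the arguments of [al] stay below a bound where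
    [cost_lip] applies. The distance 2 bounds the diameter of the unit balls on which the local
    Lipschitz property is checked later. *)
Lemma hopf_lax_lipschitz t : 0 < t ->
  exists2 L, 0 <= L & forall x y, mdist x y <= 2 -> `|Q t x - Q t y| <= L * mdist x y.
Proof.
move=> t0; pose B := (radius t + 2) / t.
exists (al (B + 1)); first exact: (cost_ge0 A).
have side x y : mdist x y <= 2 -> Q t x - Q t y <= al (B + 1) * mdist x y.
  move=> xy2; apply/ler_addgt0Pr => e e0.
  have m0 : 0 < Num.min e 1 by rewrite lt_min e0 ltr01.
  have m1 : Num.min e 1 <= 1 by rewrite ge_min lexx orbT.
  have me : Num.min e 1 <= e by rewrite ge_min lexx.
  have [z Hz yz] := hopf_lax_near y t0 (lexx t) m0 m1.
  have Hx := hopf_lax_le x z t0.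
  have xz : mdist x z <= mdist x y + mdist y z := metric_triangle _ _ _.
  have xy0 : 0 <= mdist x y := mdist_ge0 _ _.
  have xz0 : 0 <= mdist x z := mdist_ge0 _ _.
  have yz0 : 0 <= mdist y z := mdist_ge0 _ _.
  have H1 : al (mdist x z / t) <= al ((mdist x y + mdist y z) / t).
    apply: (cost_mono A); first by rewrite divr_ge0// ltW.
    by rewrite ler_pM2r ?invr_gt0.
  have H2 : al ((mdist x y + mdist y z) / t) - al (mdist y z / t) <=
      ((mdist x y + mdist y z) / t - mdist y z / t) * al (B + 1).
    apply: (cost_lip A).
    - by rewrite divr_ge0// ltW.
    - by rewrite ler_pM2r ?invr_gt0//; lra.
    - by rewrite /B ler_pM2r ?invr_gt0//; lra.
  have := ler_wpM2l (ltW t0) (le_trans (lerB H1 (lexx (al (mdist y z / t)))) H2).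
  have -> : t * (((mdist x y + mdist y z) / t - mdist y z / t) * al (B + 1)) =
    al (B + 1) * mdist x y by field; rewrite gt_eqF.
  lra.
move=> x y xy; rewrite ler_norml side// andbT lerNl opprB metric_sym.
by apply: side; rewrite metric_sym.
Qed.

Let time_cost_mono D t t' : 0 <= D -> 0 < t -> t <= t' ->
  t' * al (D / t') <= t * al (D / t).
Proof.
move=> D0 t0 tt'; have t'0 : 0 < t' by lra.
have := @cost_scale _ _ A (t / t') (D / t).
have -> : t / t' * (D / t) = D / t' by field; rewrite !gt_eqF.
have s1 : t / t' <= 1 by rewrite ler_pdivrMr// mul1r.
move=> /(_ (divr_ge0 (ltW t0) (ltW t'0)) s1)/(ler_wpM2l (ltW t'0)).
by rewrite mulrA [t' * (t / _)]mulrC divfK ?gt_eqF.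
Qed.

Lemma hopf_lax_nonincreasing t t' x : 0 < t -> t <= t' -> Q t' x <= Q t x.
Proof.
move=> t0 tt'; have t'0 : 0 < t' by lra.
apply: lb_le_inf; first by case: (Q_has_inf x t0).
move=> _ [z _ <-]; apply: le_trans (hopf_lax_le x z t'0) _.
by rewrite lerD2l time_cost_mono// mdist_ge0.
Qed.

Lemma hopf_lax_time_lipschitz a T : 0 < a -> a <= T ->
  exists2 L, 0 <= L & forall t t' x, a <= t -> t <= t' -> t' <= T ->
    Q t x - Q t' x <= L * (t' - t).
Proof.
move=> a0 aT; pose B := radius T / a.
have [b0|bn] := leP 0 b; last first.
  by exists 0 => // t t' x; have := b_ge0 x; lra.
have R0 : 0 <= radius T.
  by have al1 := cost_gt0 A; rewrite addr_ge0//; [lra|rewrite divr_ge0//; lra].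
exists (T * (B / a) * al (B + 1)).
  apply: mulr_ge0; last exact: (cost_ge0 A).
  apply: mulr_ge0; first lra.
  by rewrite divr_ge0 ?(ltW a0)//; rewrite divr_ge0// ltW.
move=> t t' x at_ tt' t'T; apply/ler_addgt0Pr => e e0.
have [t0 t'0] : 0 < t /\ 0 < t' by lra.
have m0 : 0 < Num.min e 1 by rewrite lt_min e0 ltr01.
have m1 : Num.min e 1 <= 1 by rewrite ge_min lexx orbT.
have me : Num.min e 1 <= e by rewrite ge_min lexx.
have [z Hz xz] := hopf_lax_near x t'0 t'T m0 m1.
have Hx := hopf_lax_le x z t0.
have xz0 : 0 <= mdist x z := mdist_ge0 _ _.
set D := mdist x z in Hz xz Hx xz0 *.
have H : al (D / t) - al (D / t') <= (D / t - D / t') * al (B + 1).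
  apply: (cost_lip A).
  - by rewrite divr_ge0// ltW.
  - by apply: ler_wpM2l => //; rewrite lef_pV2.
  - by apply: ler_pM => //; [rewrite invr_ge0 ltW|rewrite lef_pV2].
have e1 : D / t - D / t' <= B / a * (t' - t).
  have -> : D / t - D / t' = D / (t * t') * (t' - t) by field; rewrite !gt_eqF.
  apply: ler_wpM2r; first lra.
  rewrite /B -mulrA -invfM; apply: ler_pM => //; first by rewrite invr_ge0 mulr_ge0// ltW.
  by rewrite lef_pV2 ?posrE ?mulr_gt0//; apply: ler_pM; lra.
have p0 : 0 <= al (B + 1) := cost_ge0 A _.
have p1 := ler_wpM2r p0 e1.
have p2 : t * (al (D / t) - al (D / t')) <= T * (B / a) * al (B + 1) * (t' - t).
  have -> : T * (B / a) * al (B + 1) * (t' - t) = T * (B / a * (t' - t) * al (B + 1)) by ring.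
  apply: ler_pM; [lra| |lra|exact: le_trans H p1].
  rewrite subr_ge0; apply: (cost_mono A); first by rewrite divr_ge0// ltW.
  by apply: ler_wpM2l => //; rewrite lef_pV2.
have p3 : t * al (D / t') <= t' * al (D / t').
  by apply: ler_wpM2r => //; exact: (cost_ge0 A).
lra.
Qed.

Hypothesis SC : semiconcave_cost al.

(** An infimum of uniformly semiconcave functions is semiconcave: a near-minimizer at the middle
    time t1 competes at t0 and t2, and it lies within [radius T], where the constant is uniform. *)
Lemma hopf_lax_semiconcave a T : 0 < a -> a <= T ->
  exists2 L, 0 <= L & forall t0 t1 t2 x, a <= t0 -> t0 < t1 -> t1 < t2 -> t2 <= T ->
    (t2 - t1) * (Q t0 x - Q t1 x) <=
    (t1 - t0) * (Q t1 x - Q t2 x) + L * (t2 - t1) * (t1 - t0) * (t2 - t0).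
Proof.
move=> a0 aT; have [b0|bn] := leP 0 b; last first.
  by exists 0 => // t0 t1 t2 x; have := b_ge0 x; lra.
have R0 : 0 <= radius T.
  by have al1 := cost_gt0 A; rewrite addr_ge0//; [lra|rewrite divr_ge0//; lra].
have [L L0 HL] := SC a0 R0; exists L => // t0 t1 t2 x at0 t01 t12 t2T.
have [p0 [p1 p2]] : 0 < t0 /\ 0 < t1 /\ 0 < t2 by lra.
have s0 : 0 < t2 - t0 by lra.
apply/ler_addgt0Pr => e e0.
(* The near-minimality error enters with the weights t2 - t1 and t1 - t0, hence t2 - t0 in total. *)
have m0 : 0 < Num.min (e / (t2 - t0)) 1 by rewrite lt_min divr_gt0// ltr01.
have m1 : Num.min (e / (t2 - t0)) 1 <= 1 by rewrite ge_min lexx orbT.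
have me : Num.min (e / (t2 - t0)) 1 <= e / (t2 - t0) by rewrite ge_min lexx.
have [z Hz xz] := hopf_lax_near x p1 (ltac:(lra) : t1 <= T) m0 m1.
have H0 := hopf_lax_le x z p0; have H2 := hopf_lax_le x z p2.
have := HL _ _ _ _ (mdist_ge0 x z) xz at0 t01 t12.
set M := Num.min _ _ in m0 m1 me Hz *.
have q1 : 0 <= t1 - t0 by lra.
have q2 : 0 <= t2 - t1 by lra.
have r1 : (t2 - t1) * (Q t0 x - Q t1 x) <= (t2 - t1) *
  (t0 * al (mdist x z / t0) - t1 * al (mdist x z / t1) + M).
  by apply: ler_wpM2l => //; lra.
have r2 : (t1 - t0) * (t1 * al (mdist x z / t1) - t2 * al (mdist x z / t2) - M) <=
  (t1 - t0) * (Q t1 x - Q t2 x).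
  by apply: ler_wpM2l => //; lra.
have : M * (t2 - t0) <= e by rewrite -ler_pdivlMr.
lra.
Qed.

End hopf_lax.

Section slopes.
Context {d : measure_display} {R : realType}.
Variable X : completeBorelMetricType d R.
Implicit Types (f : X -> R) (part : R -> R).

Lemma dnbhs_nonisolated (x : X) : ~ isolated [set: X] x -> ~ x^' set0.
Proof.
move=> niso x0; apply: niso; split; first by rewrite inE.
exists [set y | y != x -> set0 y]; first exact: x0.
rewrite setIT; apply/seteqP; split => [y /= Hy|_ -> /=]; last by rewrite eqxx.
by apply/eqP; apply/negPn/negP.
Qed.

Lemma slope_le part f x (B : R) : (forall a, 0 <= part a) -> 0 <= B ->
  (\forall y \near x^', part (f y - f x) / mdist y x <= B) ->
  slope part f x <= B.
Proof.
move=> part0 B0 H; rewrite /slope; case: asboolP => // niso.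
set l := limf_esup _ _.
have l0 : (0 <= l)%E.
  apply: limf_esup_ge0; first exact: dnbhs_nonisolated.
  by move=> y; rewrite lee_fin divr_ge0// mdist_ge0.
have lB : (l <= B%:E)%E.
  apply: le_trans (ereal_inf_lbound _) _.
    by exists [set y | part (f y - f x) / mdist y x <= B].
  by apply: ge_ereal_sup => _ [y /= Hy <-]; rewrite lee_fin.
by move: l0 lB; case: l => [r| |]//=; rewrite ?lee_fin.
Qed.

Lemma slope_ge0 part f x : (forall a, 0 <= part a) -> 0 <= slope part f x.
Proof.
move=> part0; rewrite /slope; case: asboolP => // niso.
apply: fine_ge0; apply: limf_esup_ge0; first exact: dnbhs_nonisolated.
by move=> y; rewrite lee_fin divr_ge0// mdist_ge0.
Qed.

Lemma pos_part_ge0 (a : R) : 0 <= pos_part a.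
Proof. by rewrite /pos_part le_max lexx orbT. Qed.

Lemma neg_part_ge0 (a : R) : 0 <= neg_part a.
Proof. by rewrite /neg_part le_max lexx orbT. Qed.

End slopes.

(** * The Hamilton-Jacobi inequality in finite increments *)

Section hamilton_jacobi.
Context {d : measure_display} {R : realType}.
Variable X : completeBorelMetricType d R.
Variable al : R -> R.
Hypotheses (A : convex_cost al) (SC : semiconcave_cost al).
Variables (f : X -> R) (b : R).
Hypothesis fb : forall x, `|f x| <= b.
Local Notation Q := (hopf_lax al f).

(** Discrete substitute for - d/dt Q_t f(x). The term M h pays, through semiconcavity, for comparing
    the increment over [t, t + h] with shorter ones on either side of t. *)
Definition time_slope (M t h : R) (x : X) : R := (Q t x - Q (t + h) x) / h + M * h.

(* No minimizers are needed here: with h' = d(x,y)/w the semigroup inequality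
   bounds the increment in space by an increment in time over h'. *)
Lemma hopf_lax_increments (a T : R) : 0 < a -> a <= T ->
  exists2 M, 0 <= M & forall t h x, a <= t -> 0 < h -> t + h <= T ->
    forall w, 0 < w -> \forall y \near x^',
      w * (`|Q t y - Q t x| / mdist y x) <= time_slope M t h x + al w.
Proof.
move=> a0 aT.
have [L L0 HL] := hopf_lax_semiconcave A fb SC (ltac:(lra) : 0 < a / 2)
  (ltac:(lra) : a / 2 <= T).
exists (2 * L); first by rewrite mulr_ge0.
move=> t h x at_ h0 thT w w0.
(* Makes mdist x y / w smaller than h and than a / 2, so that the backward time stays above a / 2,
   where semiconcavity was taken. *)
pose r := w * Num.min h (a / 2).
have r0 : 0 < r by rewrite mulr_gt0// lt_min h0; lra.
have Hr : \forall y \near x^', mdist x y < r /\ x != y.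
  apply: filterI; last by apply: filterS (nbhs_dnbhs_neq x) => y; rewrite eq_sym.
  apply: nbhs_dnbhs; apply: filterS (nbhsx_ballx x _ r0) => y.
  by rewrite ballEmdist.
apply: filterS Hr => y [xyr xy].
have D0 : 0 < mdist x y by rewrite mdist_gt0.
rewrite metric_sym; set D := mdist x y in xyr D0 *.
pose k := D / w; have k0 : 0 < k by rewrite divr_gt0.
have kr : k < Num.min h (a / 2) by rewrite /k ltr_pdivrMr// mulrC.
have [kh ka] : k < h /\ k < a / 2 by move: kr; rewrite lt_min => /andP.
have Dk : D / k = w by rewrite /k; field; rewrite !gt_eqF.
have t0 : 0 < t by lra.
rewrite mulrCA -invf_div -/k.
rewrite ler_pdivrMr//.
(* [lower] bounds the drop of Q t from x to y by the time increment over [t, t + k], [upper] its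
   rise by the one over [t - k, t]. Semiconcavity then compares both with the increment over
   [t, t + h]. *)
have lower := hopf_lax_semigroup A fb x y t0 k0.
rewrite -/D Dk in lower.
have tk0 : 0 < t - k by lra.
have upper := hopf_lax_semigroup A fb y x tk0 k0.
rewrite subrK metric_sym -/D Dk in upper.
have S1 := HL t (t + k) (t + h) x ltac:(lra) ltac:(lra) ltac:(lra) thT.
have S2 := HL (t - k) t (t + h) x ltac:(lra) ltac:(lra) ltac:(lra) thT.
have e1 : (t + h - (t + k)) = h - k by ring. 
have e2 : t + k - t = k by ring.
have e3 : t + h - t = h by ring.
have e4 : t - (t - k) = k by ring.
have e5 : t + h - (t - k) = h + k by ring.
rewrite e1 e2 e3 in S1; rewrite e3 e4 e5 in S2.
have hi0 : 0 <= h^-1 by rewrite invr_ge0 ltW.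
have hh : h^-1 * h = 1 by rewrite mulVf ?gt_eqF.
have K1 : Q t x - Q (t + k) x <= (Q t x - Q (t + h) x) / h * k + L * k * (h - k).
  rewrite -(ler_pM2l h0).
  have -> : h * ((Q t x - Q (t + h) x) / h * k + L * k * (h - k)) =
    k * (Q t x - Q (t + h) x) + L * (h - k) * k * h by field; rewrite gt_eqF.
  lra.
have K2 : Q (t - k) x - Q t x <= (Q t x - Q (t + h) x) / h * k + L * k * (h + k).
  rewrite -(ler_pM2l h0).
  have -> : h * ((Q t x - Q (t + h) x) / h * k + L * k * (h + k)) =
    k * (Q t x - Q (t + h) x) + L * h * k * (h + k) by field; rewrite gt_eqF.
  lra.
have Lk : 0 <= L * k by rewrite mulr_ge0// ltW.
have Lkk : 0 <= L * k * k by rewrite mulr_ge0// ltW.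
have Lkh : L * k * k <= L * k * h by rewrite ler_wpM2l// ltW.
rewrite /time_slope ler_norml; apply/andP; split; lra.
Qed.

(** Each term of the supremum is bounded separately: w = s w' trades the factor s^m for the scaling
    of [al], and the slope is estimated with the weight w'. Terms with w <= 0 are harmless since
    slopes are nonnegative. Both gradients are covered because each part is at most the absolute
    value. *)
Lemma fenchel_slope_le (a T : R) : 0 < a -> a <= T ->
  exists2 M, 0 <= M & forall t h x, a <= t -> 0 < h -> t + h <= T ->
    0 <= time_slope M t h x /\
    forall part : R -> R, part = (@pos_part R) \/ part = neg_part ->
    forall s m : R, 0 < s ->
    (forall u, 0 <= u -> s `^ (m + 1) * al u <= al (s * u)) ->
    (fenchel al (slope part (fun y : X => s `^ m * Q t y)%R x) <=
      (s `^ (m + 1) * time_slope M t h x)%R%:E)%E.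
Proof.
move=> a0 aT; have [M M0 HM] := hopf_lax_increments a0 aT.
exists M => // t h x at_ h0 thT; have {}HM := HM t h x at_ h0 thT.
have t0 : 0 < t by lra.
have V0 : 0 <= time_slope M t h x.
  apply: addr_ge0; last by rewrite mulr_ge0// ltW.
  rewrite divr_ge0 ?(ltW h0)// subr_ge0.
  by apply: (hopf_lax_nonincreasing A fb); lra.
split=> // part hpart s m s0 Hs.
have part0 u : 0 <= part u.
  by case: hpart => ->; [exact: pos_part_ge0|exact: neg_part_ge0].
have partn u : part u <= `|u|.
  case: hpart => ->; rewrite ge_max normr_ge0 andbT ?ler_norm//.
  by rewrite -normrN ler_norm.
set V := time_slope M t h x in V0 HM *.
have sm0 : 0 < s `^ m by exact: powR_gt0.
have smE : s * s `^ m = s `^ (m + 1).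
  by rewrite powRD ?powRr1 ?(ltW s0) 1?mulrC//; apply/implyP => _; rewrite gt_eqF.
apply: ge_ereal_sup => _ [w _ <-]; rewrite lee_fin.
have sl0 : 0 <= slope part (fun y : X => s `^ m * Q t y) x by exact: slope_ge0.
have [w0|w0] := leP w 0.
  apply: (@le_trans _ _ 0); last by rewrite mulr_ge0// powR_ge0.
  have := cost_ge0 A w; have : w * slope part (fun y : X => s `^ m * Q t y) x <= 0.
    exact: mulr_le0_ge0.
  lra.
pose w' := w / s; have w'0 : 0 < w' by rewrite divr_gt0.
have ww' : w = s * w' by rewrite /w' mulrC divfK ?gt_eqF.
have sl : slope part (fun y : X => s `^ m * Q t y) x <= s `^ m * (V + al w') / w'.
  apply: slope_le => //.
    by rewrite divr_ge0 ?(ltW w'0)// mulr_ge0 ?powR_ge0// addr_ge0// (cost_ge0 A).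
  apply: filterS (HM w' w'0) => y Hy.
  apply: (@le_trans _ _ (s `^ m * (`|Q t y - Q t x| / mdist y x))).
    rewrite mulrA; apply: ler_wpM2r; first by rewrite invr_ge0 mdist_ge0.
    by rewrite -mulrBr; apply: le_trans (partn _) _; rewrite normrM (gtr0_norm sm0).
  rewrite -mulrA; apply: ler_wpM2l; first exact: ltW.
  by rewrite ler_pdivlMr// mulrC.
have := ler_wpM2l (ltW w0) sl.
have -> : w * (s `^ m * (V + al w') / w') = s `^ (m + 1) * (V + al w').
  by rewrite -smE [in LHS]ww'; field; rewrite gt_eqF.
have := Hs w' (ltW w'0); rewrite -ww' mulrDr.
lra.
Qed.

Lemma hopf_lax_locally_lipschitz (t c : R) : 0 < t ->
  locally_lipschitz (fun x : X => c * Q t x).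
Proof.
move=> t0 x; have [L L0 HL] := hopf_lax_lipschitz A fb t0.
exists 1 => //; exists (`|c| * L) => _ [[y z] /= [xy xz yz]] <-.
have D0 : 0 < mdist y z by rewrite mdist_gt0.
rewrite ler_pdivrMr// -mulrBr normrM -mulrA; apply: ler_wpM2l => //.
apply: HL; apply: le_trans (metric_triangle _ x _) _.
move: xy xz; rewrite !ballEmdist/= metric_sym; lra.
Qed.

Lemma hopf_lax_continuous (t : R) : 0 < t -> continuous (Q t : X -> R).
Proof.
move=> t0 x; have [L L0 HL] := hopf_lax_lipschitz A fb t0.
apply/cvgrPdist_lt => e e0.
have d0 : 0 < Num.min 1 (e / (L + 1)) by rewrite lt_min ltr01 divr_gt0//; lra.
apply: filterS (nbhsx_ballx x _ d0) => y; rewrite ballEmdist/= lt_min => /andP[xy1 xy2].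
apply: le_lt_trans (HL x y _) _; first lra.
have : mdist x y * (L + 1) < e by rewrite -ltr_pdivlMr//; lra.
by have := mdist_ge0 x y; lra.
Qed.

Lemma hopf_lax_measurable (t : R) : 0 < t -> measurable_fun setT (Q t : X -> R).
Proof.
move=> t0; apply: (measurability _ (RGenOpens.measurableE R)).
move=> _ [_ [u [v ->]] <-]; rewrite setTI borel_measurableE.
apply: sub_sigma_algebra.
by move/continuousP : (hopf_lax_continuous t0); apply; exact: interval_open.
Qed.

End hamilton_jacobi.

(** * The logarithmic Sobolev inequality along the flow *)

Section log_sobolev_flow.
Context {d : measure_display} {R : realType}.
Variable X : completeBorelMetricType d R.
Variable mu : probability X R.
Variable part : R -> R.
Hypothesis hpart : part = (@pos_part R) \/ part = (@neg_part R).

(* LSI_plus and LSI_minus are the instances [pos_part] and [neg_part]. *)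
Definition LSI (al : R -> R) (A : R) :=
  forall f : X -> R, bounded_fun f -> locally_lipschitz f ->
    (entropy mu (expR \o f) <=
     A%:E * \int[mu]_x (fenchel al (slope part f x) * (expR (f x))%:E))%E.

Lemma fenchel_ge0 (al : R -> R) (y : R) : al 0 = 0 -> (0 <= fenchel al y)%E.
Proof.
by move=> al0; apply: ereal_sup_ubound; exists 0 => //; rewrite mul0r al0 subr0.
Qed.

(** A smaller cost has a larger conjugate, hence a weaker inequality; this passes to the average of
    the cost over scales. *)
Lemma LSI_le (al al' : R -> R) (A : R) : 0 <= A -> al 0 = 0 -> (forall x, al' x <= al x) ->
  LSI al A -> LSI al' A.
Proof.
move=> A0 al0 H lsi f bf lf; apply: le_trans (lsi f bf lf) _.
apply: lee_wpmul2l; first by rewrite lee_fin.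
apply: ge0_le_integral_nonmeasurable => x.
  by rewrite mule_ge0 ?fenchel_ge0// lee_fin expR_ge0.
apply: lee_wpmul2r; first by rewrite lee_fin expR_ge0.
apply: ge_ereal_sup => _ [w _ <-].
apply: (@le_trans _ _ (w * slope part f x - al' w)%:E); first by rewrite lee_fin lerB.
by apply: ereal_sup_ubound; exists w.
Qed.

Lemma LSI_real (al : R -> R) (A : R) (f V : X -> R) : 0 <= A -> al 0 = 0 ->
  LSI al A -> bounded_measurable f -> locally_lipschitz f ->
  bounded_measurable V -> (forall x, (fenchel al (slope part f x) <= (V x)%:E)%E) ->
  \int[mu]_x (f x * expR (f x)) - (\int[mu]_x expR (f x)) * ln (\int[mu]_x expR (f x))
    <= A * \int[mu]_x (V x * expR (f x)).
Proof.
move=> A0 al0 lsi bf lf bV HV.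
have be := bounded_measurable_expR bf.
have Z0 := Rintegral_expR_gt0 mu bf.
set Z := Rintegral _ _ _ in Z0 *.
have := lsi f (bounded_measurable_bounded_fun bf) lf.
rewrite /entropy -/Z.
have -> : (\int[mu]_x ((expR \o f) x * ln ((expR \o f) x / \int[mu]_y (expR \o f) y)%R)%:E
   = (\int[mu]_x (f x * expR (f x)) - Z * ln Z)%R%:E)%E.
  have bfe := bounded_measurableM bf be.
  have bze := bounded_measurableZ (- ln Z) be.
  under eq_integral => x _.
    rewrite /= ln_div ?posrE ?expR_gt0// expRK mulrBr [expR _ * f x]mulrC [_ * ln _]mulrC -mulNr.
    over.
  rewrite Rintegral_EFin; last exact: bounded_measurableD.
  by rewrite bm_RintegralD// bm_RintegralZ// mulNr [ln _ * _]mulrC.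
move=> H; rewrite -lee_fin; apply: le_trans H _.
rewrite EFinM; apply: lee_wpmul2l; first by rewrite lee_fin.
rewrite -Rintegral_EFin; last exact: bounded_measurableM.
apply: ge0_le_integral_nonmeasurable => x.
  by rewrite mule_ge0 ?fenchel_ge0// lee_fin expR_ge0.
by rewrite EFinM; apply: lee_wpmul2r; rewrite ?lee_fin ?expR_ge0.
Qed.

Variables (al : R -> R) (A : R).
Hypotheses (C : convex_cost al) (SC : semiconcave_cost al).
Hypotheses (A0 : 0 < A) (lsi : LSI al A).
Variables (f : X -> R) (b : R).
Hypothesis fb : forall x, `|f x| <= b.
Local Notation Q := (hopf_lax al f).

Lemma hopf_lax_bm (t : R) : 0 < t -> bounded_measurable (Q t : X -> R).
Proof.
move=> t0; split; first exact: (hopf_lax_measurable C fb).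
by exists b => x; exact: (hopf_lax_bounded C fb).
Qed.

Definition exp_mean (k : R) (g : X -> R) := ln (\int[mu]_x expR (k * g x)) / k.

(* With k(t) = (t/a)^m, the logarithmic Sobolev inequality for k Q_t controls
   the derivative of [exp_mean (k t) (Q t)]; the growth of k is matched to the
   scaling inequality for al. *)
Lemma exp_mean_nonincreasing (a m t1 t2 : R) : 0 < a -> 0 <= m -> m * A <= a ->
  0 < t1 -> t1 <= t2 ->
  (forall t, t1 <= t -> t <= t2 -> forall u, 0 <= u ->
    (t / a) `^ (m + 1) * al u <= al (t / a * u)) ->
  exp_mean ((t2 / a) `^ m) (Q t2) <= exp_mean ((t1 / a) `^ m) (Q t1).
Proof.
move=> a0 m0 mA t10 t12 Hs.
have [M M0 HM] := fenchel_slope_le C SC fb t10 t12.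
have [L L0 HL] := hopf_lax_time_lipschitz C fb t10 t12.
pose b' := `|b|; have b'0 : 0 <= b' := normr_ge0 b.
pose kmin := (t1 / a) `^ m; pose kmax := (t2 / a) `^ m.
pose S1 := (t1 / a) `^ (m + 1).
have s10 : 0 < t1 / a by rewrite divr_gt0.
have kmin0 : 0 < kmin by exact: powR_gt0.
have kmax0 : 0 < kmax by apply: powR_gt0; rewrite divr_gt0//; lra.
have S10 : 0 < S1 by exact: powR_gt0.
(* Uniform constants: [Del] bounds (k' - k) / h, [Y] bounds the change of the exponent k Q_t f per
   unit of time, and [N] collects the second-order terms. *)
pose Del := kmax ^+ 2 / (A * S1).
have Del0 : 0 <= Del by rewrite divr_ge0 ?sqr_ge0// mulr_ge0 ?(ltW A0)// ltW.
pose Y := Del * b' + kmax * (L + M) + kmax * M.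
have Y0 : 0 <= Y.
  by rewrite !addr_ge0// mulr_ge0 ?addr_ge0// ltW.
pose N := kmax * M + 2 * Y ^+ 2.
have N0 : 0 <= N by rewrite addr_ge0 ?mulr_ge0 ?sqr_ge0// ltW.
apply: (@quadratic_error_nonincreasing _
  (fun t => exp_mean ((t / a) `^ m) (Q t)) (N / kmin)) => //.
exists (2 * (Y + 1))^-1; first by rewrite invr_gt0; lra.
move=> t h t1t h0 hh tht2.
have t0 : 0 < t by lra.
have th0 : 0 < t + h by lra.
have hY : h * Y <= 2^-1 /\ h <= 1.
  have : h * (2 * (Y + 1)) <= 1 by rewrite -ler_pdivlMr; lra.
  have : 0 <= h * Y by rewrite mulr_ge0// ltW.
  lra.
case: hY => hY h1.
pose s := t / a; pose s' := (t + h) / a.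
have s0 : 0 < s by rewrite divr_gt0.
have ss' : s <= s' by rewrite ler_pM2r ?invr_gt0//; lra.
have s's : s' - s = h / a by rewrite /s /s'; field; rewrite gt_eqF.
pose k := s `^ m; pose k' := s' `^ m.
have k0 : 0 < k by exact: powR_gt0.
have kk' : k <= k' by rewrite ge0_ler_powR// nnegrE ltW//; lra.
have k'0 : 0 < k' by lra.
have kmink : kmin <= k.
  by rewrite ge0_ler_powR// ?nnegrE ?(ltW s10) ?(ltW s0)// ler_pM2r ?invr_gt0.
have k'kmax : k' <= kmax.
  rewrite ge0_ler_powR// ?nnegrE; [lra| |by rewrite ler_pM2r ?invr_gt0].
  by rewrite divr_ge0//; lra.
pose S := s `^ (m + 1).
have S0 : 0 < S by exact: powR_gt0.
have S1S : S1 <= S.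
  by rewrite ge0_ler_powR ?nnegrE ?(ltW s10) ?(ltW s0)//; [lra|rewrite ler_pM2r ?invr_gt0].
(* The increment of 1/k is at most (m / a) h / S, and m A <= a turns this into h / (A S), which is
   what the entropy bound can absorb. *)
pose rho := k^-1 - k'^-1.
have rho0 : 0 <= rho by rewrite subr_ge0 lef_pV2.
have rhoh : rho <= h / (A * S).
  have mh : m * (h / a) <= h / A.
    rewrite mulrA ler_pdivrMr// mulrAC ler_pdivlMr// mulrAC [leRHS]mulrC.
    by rewrite ler_pM2r.
  apply: le_trans (powRN_tangent m0 s0 ss') _; rewrite s's -/S.
  have -> : h / (A * S) = h / A / S by rewrite invfM mulrA.
  by rewrite ler_pM2r ?invr_gt0.
pose V := time_slope al f M t h.
have [HVge HVle] : (forall x, 0 <= V x) /\ forall x, V x <= L + M.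
  split=> x; first by case: (HM t h x t1t h0 tht2).
  rewrite /V /time_slope; apply: lerD.
    rewrite ler_pdivrMr//; have := HL t (t + h) x t1t ltac:(lra) tht2.
    by rewrite addrAC subrr add0r.
  by rewrite -[leRHS]mulr1; exact: ler_wpM2l.
have bq := hopf_lax_bm t0; have bq' := hopf_lax_bm th0.
set q := Q t in bq *; set q' := Q (t + h) in bq' *.
(* An identity, since [V] is a corrected difference quotient; for the same reason [V] is bounded and
   measurable. *)
have q'E x : q' x = q x - h * V x + M * h ^+ 2.
  by rewrite /V /time_slope -/q -/q'; field; rewrite gt_eqF.
have bV : bounded_measurable V.
  have -> : V = (fun x => h^-1 * (q x + (-1) * q' x) + M * h).
    by apply/funext => x; rewrite /V /time_slope -/q -/q' mulrC mulN1r.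
  apply: bounded_measurableD (bounded_measurable_cst _).
  by apply: bounded_measurableZ; apply: bounded_measurableD => //; exact: bounded_measurableZ.
have bkq := bounded_measurableZ k bq.
have be := bounded_measurable_expR bkq.
have be' := bounded_measurable_expR (bounded_measurableZ k' bq').
have bqe := bounded_measurableM bq be.
have bVe := bounded_measurableM bV be.
have Z0 := Rintegral_expR_gt0 mu bkq.
have Z'0 := Rintegral_expR_gt0 mu (bounded_measurableZ k' bq').
set Z := Rintegral _ _ _ in Z0; set Z' := Rintegral _ _ _ in Z'0.
pose I := \int[mu]_x (q x * expR (k * q x)).
pose W := \int[mu]_x (V x * expR (k * q x)).
have IE : \int[mu]_x (k * q x * expR (k * q x)) = k * I.
  by rewrite -bm_RintegralZ//; apply: eq_Rintegral => x _; rewrite mulrA.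
have ent : k * I - Z * ln Z <= A * (S * W).
  rewrite -IE; apply: le_trans
    (LSI_real (ltW A0) (cost0 C) lsi bkq _ (bounded_measurableZ S bV) _) _.
  - exact: (hopf_lax_locally_lipschitz C fb).
  - move=> x; have [_ H] := HM t h x t1t h0 tht2.
    by apply: H => // u u0; apply: Hs => //; lra.
  - have -> : S * W = \int[mu]_x (S * V x * expR (k * q x)).
      by rewrite -bm_RintegralZ//; apply: eq_Rintegral => x _; rewrite mulrA.
    exact: lexx.
have ent0 : 0 <= k * I - Z * ln Z.
  by rewrite subr_ge0 -IE; exact: jensen_expR.
pose del := k' - k.
have delE : del = k * k' * rho by rewrite /del /rho; field; rewrite !gt_eqF.
have del0 : 0 <= del by rewrite subr_ge0.
have delh : del <= Del * h.
  rewrite delE /Del.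
  have -> : kmax ^+ 2 / (A * S1) * h = kmax * kmax * (h / (A * S1)) by rewrite expr2; ring.
  apply: ler_pM => //; first by rewrite mulr_ge0// ltW.
    by apply: ler_pM => //; [exact: ltW|exact: ltW|exact: le_trans kk' k'kmax].
  apply: le_trans rhoh _; rewrite ler_pM2l// lef_pV2 ?posrE ?mulr_gt0//.
  by rewrite ler_pM2l.
have pt x : expR (k' * q' x) <= expR (k * q x) + del * (q x * expR (k * q x))
    + (- (k' * h)) * (V x * expR (k * q x)) + N * h ^+ 2 * expR (k * q x).
  pose y := del * q x - k' * h * V x + k' * M * h ^+ 2.
  have -> : k' * q' x = k * q x + y by rewrite q'E /y /del; ring.
  have qb : `|q x| <= b'.
    by apply: le_trans (hopf_lax_bounded C fb x t0) (ler_norm _).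
  have h20 : 0 <= h ^+ 2 := sqr_ge0 h.
  have h2h : h ^+ 2 <= h by rewrite expr2 ger_pMr.
  have yY : `|y| <= h * Y.
    apply: le_trans (ler_normD _ _) _.
    have -> : h * Y = Del * h * b' + kmax * h * (L + M) + kmax * M * h by rewrite /Y; ring.
    apply: lerD; [apply: le_trans (ler_normB _ _) _; apply: lerD|].
    - by rewrite normrM; apply: ler_pM; rewrite ?normr_ge0// ger0_norm.
    - rewrite ger0_norm; last by rewrite !mulr_ge0// ltW.
      apply: ler_pM => //; first by rewrite mulr_ge0// ltW.
      by rewrite ler_pM2r.
    - rewrite ger0_norm; last by rewrite !mulr_ge0// ltW.
      apply: ler_pM => //; first by rewrite mulr_ge0// ltW.
      by apply: ler_wpM2r.
  have := expR_le_quadratic (le_trans yY hY).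
  have y2 : y ^+ 2 <= h ^+ 2 * Y ^+ 2.
    rewrite -exprMn -(real_normK (num_real y)) ler_pXn2r// nnegrE.
    exact: le_trans (normr_ge0 y) yY.
  move=> ey; rewrite expRD; set E := expR (k * q x).
  have E0 : 0 <= E := expR_ge0 _.
  have kM : k' * M * h ^+ 2 <= kmax * M * h ^+ 2.
    by apply: ler_wpM2r => //; apply: ler_wpM2r.
  have : expR y <= 1 + del * q x + (- (k' * h)) * V x + N * h ^+ 2.
    by rewrite /N; move: ey y2 kM; rewrite /y; lra.
  move=> /(ler_wpM2l E0) /le_trans; apply; rewrite le_eqVlt; apply/orP; left.
  by apply/eqP; ring.
have ineq : Z' <= Z + del * I - k' * h * W + N * h ^+ 2 * Z.
  have b1 := bounded_measurableZ del bqe.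
  have b2 := bounded_measurableZ (- (k' * h)) bVe.
  have b3 := bounded_measurableZ (N * h ^+ 2) be.
  have b4 := bounded_measurableD be b1.
  have b5 := bounded_measurableD b4 b2.
  apply: le_trans (bm_le_Rintegral mu be' (bounded_measurableD b5 b3) pt) _.
  rewrite !bm_RintegralD// !bm_RintegralZ// -/Z -/I -/W; lra.
rewrite /exp_mean -/s -/s' -/k -/k' -/q -/q' -/Z -/Z'.
exact: (ln_mean_step Z0 Z'0 kmin0 kmink kk' (ltW h0) A0 S0 N0 rhoh ent0 ent ineq).
Qed.

End log_sobolev_flow.

(** * The flow from time 0 to time 1 *)

Section flow_endpoint.
Context {d : measure_display} {R : realType}.
Variable X : completeBorelMetricType d R.
Variable mu : probability X R.
Variable part : R -> R.
Hypothesis hpart : part = (@pos_part R) \/ part = (@neg_part R).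
Variables (al : R -> R) (A p r : R).
Hypotheses (C : convex_cost al) (SC : semiconcave_cost al).
Hypotheses (A0 : 0 < A) (lsi : LSI mu part al A).
Hypotheses (p1 : 1 < p) (r1 : 1 <= r) (rp : r <= p).
Hypothesis scale_le1 : forall s u, 0 < s -> s <= 1 -> 0 <= u ->
  s `^ p * al u <= al (s * u).
Hypothesis scale_ge1 : forall s u, 1 <= s -> 0 <= u ->
  s `^ r * al u <= al (s * u).
Variables (f : X -> R).
Hypothesis bf : bounded_measurable f.
Local Notation Q := (hopf_lax al f).

Let a := (p - 1) * A.
Let a0 : 0 < a. Proof. by rewrite mulr_gt0// subr_gt0. Qed.

Lemma exp_mean_hopf_lax_small (e k c : R) : 0 < e -> 0 < k -> 0 <= c ->
  (forall x, `|f x| <= c) -> k * c <= 2^-1 ->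
  exp_mean mu k (Q e) <= \int[mu]_x f x + 2 * k * c ^+ 2.
Proof.
move=> e0 k0 c0 fc kc.
have bq : bounded_measurable (Q e : X -> R) by exact: (hopf_lax_bm C fc).
have bkq := bounded_measurableZ k bq.
have Z0 := Rintegral_expR_gt0 mu bkq.
rewrite /exp_mean ler_pdivrMr//; apply: le_trans (ln_le_subr1 Z0) _.
rewrite lerBlDr.
have bg : bounded_measurable (fun x => k * f x + (1 + 2 * (k * c) ^+ 2)).
  apply: bounded_measurableD; last exact: bounded_measurable_cst.
  exact: bounded_measurableZ.
apply: le_trans (bm_le_Rintegral mu (bounded_measurable_expR bkq) bg _) _.
  move=> x; apply: (@le_trans _ _ (expR (k * f x))).
    by rewrite ler_expR ler_pM2l//; exact: (hopf_lax_le_fun C fc).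
  have kf : `|k * f x| <= k * c by rewrite normrM gtr0_norm// ler_pM2l.
  apply: le_trans (expR_le_quadratic (le_trans kf kc)) _.
  have : (k * f x) ^+ 2 <= (k * c) ^+ 2.
    rewrite -(real_normK (num_real (k * f x))) ler_pXn2r// nnegrE.
    by rewrite mulr_ge0// ltW.
  lra.
rewrite bm_RintegralD; [|exact: bounded_measurableZ|exact: bounded_measurable_cst].
rewrite bm_RintegralZ// Rintegral_probability_cst exprMn; lra.
Qed.

Let exp_mean_min1 (c : R) : 0 < c -> c <= a ->
  exp_mean mu ((c / a) `^ (p - 1)) (Q c) <= \int[mu]_x f x.
Proof.
move=> c0 ca; apply/ler_addgt0Pr => e e0.
have [mf [c' fc']] := bf; pose b := `|c'| + 1.
have b0 : 0 < b by have := normr_ge0 c'; rewrite /b; lra.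
have fb x : `|f x| <= b.
  by apply: le_trans (fc' x) _; have := ler_norm c'; rewrite /b; lra.
have p10 : 0 < p - 1 by rewrite subr_gt0.
(* The flow starts at the time t where (t / a)^(p-1) = k, which exists because p > 1. The three
   bounds on [k] ensure t <= c, the smallness asked by [exp_mean_hopf_lax_small], and a final error
   of at most e. *)
pose k := Num.min ((c / a) `^ (p - 1)) (Num.min (2 * b)^-1 (e / (2 * b ^+ 2))).
have b20 : 0 < 2 * b ^+ 2 by rewrite mulr_gt0// exprn_gt0.
have ca0 : 0 < c / a by rewrite divr_gt0.
have k0 : 0 < k.
  by rewrite !lt_min powR_gt0//= invr_gt0 mulr_gt0//= divr_gt0.
have k1 : k <= (c / a) `^ (p - 1) by rewrite ge_min lexx.
have k2 : k * b <= 2^-1.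
  by rewrite -ler_pdivlMr// -invfM /k !ge_min lexx orbT.
have k3 : 2 * k * b ^+ 2 <= e.
  by rewrite mulrAC mulrC -ler_pdivlMr// /k !ge_min lexx !orbT.
pose t := a * k `^ (p - 1)^-1.
have t0 : 0 < t by rewrite mulr_gt0// powR_gt0.
have ta : (t / a) `^ (p - 1) = k.
  rewrite /t mulrAC divff ?gt_eqF// mul1r -powRrM mulVf ?gt_eqF// powRr1//.
  exact: ltW.
have tc : t <= c.
  rewrite /t mulrC -ler_pdivlMr//.
  have -> : c / a = ((c / a) `^ (p - 1)) `^ (p - 1)^-1.
    by rewrite -powRrM divff ?gt_eqF// powRr1// ltW.
  by rewrite ge0_ler_powR// ?nnegrE ?powR_ge0 ?invr_ge0// ltW.
apply: le_trans (_ : exp_mean mu k (Q t) <= _); last first.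
  apply: le_trans (exp_mean_hopf_lax_small t0 k0 (ltW b0) fb k2) _.
  by rewrite lerD2l.
rewrite -ta; apply: (exp_mean_nonincreasing hpart C SC A0 lsi fb) => //.
- exact: ltW.
- move=> t' tt' t'c u u0; rewrite subrK; apply: scale_le1 => //.
    by rewrite divr_gt0//; exact: lt_le_trans tt'.
  by rewrite ler_pdivrMr// mul1r; exact: le_trans ca.
Qed.

(** The maximum selects the regime: if a >= 1, time 1 is reached with the exponent p - 1; otherwise
    the exponent changes to r - 1 at t = a. In both cases the maximum is 1 / k(1). *)
Lemma exp_mean_endpoint :
  exp_mean mu (Num.max (a `^ (r - 1)) (a `^ (p - 1)))^-1 (Q 1) <= \int[mu]_x f x.
Proof.
have [a1|a1] := leP 1 a.
  have -> : Num.max (a `^ (r - 1)) (a `^ (p - 1)) = a `^ (p - 1).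
    by apply/max_idPr; apply: ler_powR => //; rewrite lerD2r.
  have := exp_mean_min1 ltr01 a1.
  by rewrite mul1r -[a^-1]powR_inv1 ?(ltW a0)// -powRrM mulN1r powRN.
have -> : Num.max (a `^ (r - 1)) (a `^ (p - 1)) = a `^ (r - 1).
  by apply/max_idPl; apply: ger_powR; [rewrite a0 ltW|rewrite lerD2r].
have := exp_mean_min1 a0 (lexx a).
apply: le_trans.
have [mf [c' fc']] := bf.
have aa m : (a / a) `^ m = 1 by rewrite divff ?gt_eqF// powR1.
have -> : (a `^ (r - 1))^-1 = (1 / a) `^ (r - 1).
  by rewrite mul1r -[a^-1]powR_inv1 ?(ltW a0)// -powRrM mulN1r powRN.
(* At t = a both powers of t / a equal 1, which glues the two regimes. *)
rewrite [X in _ <= exp_mean _ X _]aa -[X in _ <= exp_mean _ X _](aa (r - 1)).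
apply: (exp_mean_nonincreasing hpart C SC A0 lsi fc') => //.
- by rewrite subr_ge0.
- by rewrite /a ler_pM2r// lerD2r.
- exact: ltW.
- move=> t ta t1 u u0; rewrite subrK; apply: scale_ge1 => //.
  by rewrite ler_pdivlMr// mul1r.
Qed.

End flow_endpoint.

Section dual_inequality.
Context {d : measure_display} {R : realType}.
Variable X : completeBorelMetricType d R.
Variable mu : probability X R.
Variable part : R -> R.
Hypothesis hpart : part = (@pos_part R) \/ part = (@neg_part R).
Variables (al : R -> R) (A : R).
Hypotheses (Y : young_function al) (D2 : delta2 al).
Hypotheses (A0 : 0 < A) (lsi : LSI mu part al A).
Local Notation p := (p_exponent al).
Local Notation r := (r_exponent al).
Let a := (p - 1) * A.
Let Cst := Num.max (a `^ (r - 1)) (a `^ (p - 1)).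

(** The flow acts on psi / k^p with the averaged cost. Since al(D) <= k^p al(D / k), and al(D / k)
    is below the averaged cost, phi / k^p lies below Q_1 (psi / k^p). The loss k^p tends to 1 with
    k. *)
Lemma LSI_exp_integral_le (k : R) (phi psi : X -> R) : 1 < k ->
  bounded_measurable phi -> bounded_measurable psi ->
  (forall x y, phi x - psi y <= al (mdist x y)) ->
  \int[mu]_x expR (phi x / (k `^ p * Cst)) <=
  expR (\int[mu]_x psi x / (k `^ p * Cst)).
Proof.
move=> k1 bphi bpsi H.
have C := young_convex_cost Y.
have k0 : 0 < k by lra.
have kp : 0 < k `^ p by exact: powR_gt0.
have p1 := p_exponent_gt1 Y D2.
have r1 := r_exponent_ge1 Y.
have rp := r_exponent_le_p Y D2.
have a0 : 0 < a by rewrite mulr_gt0// subr_gt0.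
have Cst0 : 0 < Cst by rewrite lt_max powR_gt0.
have lek x : smooth_cost al k x <= al x.
  have [x0|x0] := leP 0 x; first exact: smooth_cost_le.
  by rewrite -(smooth_cost_even al k x) -(young_even Y); apply: smooth_cost_le => //; lra.
have lsik := LSI_le (ltW A0) (young0 Y) lek lsi.
have Ck := smooth_cost_convex_cost C k1 (young_gt0 Y).
have Sk := smooth_cost_semiconcave C k1.
have bpsi' := bounded_measurableZ (k `^ p)^-1 bpsi.
have [_ [c psic]] := bpsi'.
have le1 s u : 0 < s -> s <= 1 -> 0 <= u ->
    s `^ p * smooth_cost al k u <= smooth_cost al k (s * u).
  move=> s0 s1 u0; apply: smooth_cost_scale => //; first exact: ltW.
  by move=> x x0; exact: young_scale_le1.
have ge1 s u : 1 <= s -> 0 <= u ->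
    s `^ r * smooth_cost al k u <= smooth_cost al k (s * u).
  move=> s1 u0; apply: smooth_cost_scale => //; first lra.
  by move=> x x0; exact: young_scale_ge1.
have := exp_mean_endpoint hpart Ck Sk A0 lsik p1 r1 rp le1 ge1 bpsi'.
rewrite -/a -/Cst; set q := hopf_lax _ _ _.
have bq : bounded_measurable q by exact: (hopf_lax_bm Ck psic).
have phiq x : phi x / k `^ p <= q x.
  apply: lb_le_inf.
    by eexists; exists x.
  move=> _ [z _ <-]; rewrite mul1r divr1.
  rewrite ler_pdivrMr// mulrDl mulrAC mulVf ?gt_eqF// mul1r -lerBlDl.
  apply: le_trans (H x z) _.
  have D0 : 0 <= mdist x z := mdist_ge0 _ _.
  have := smooth_cost_ge C k1 D0 => /(ler_wpM2l (ltW kp)); rewrite [leRHS]mulrC.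
  apply: le_trans.
  have ki : k^-1 <= 1 by rewrite invf_le1// ltW.
  have := young_scale_le1 Y D2 (ltac:(by rewrite invr_gt0) : 0 < k^-1) ki D0.
  move=> /(ler_wpM2l (ltW kp)).
  rewrite mulrA [k^-1 * _]mulrC -[k^-1]powR_inv1 ?(ltW k0)// -powRrM mulN1r powRN.
  by rewrite mulfV ?mul1r// gt_eqF.
rewrite /exp_mean invrK bm_RintegralZ//.
have Z0 := Rintegral_expR_gt0 mu (bounded_measurableZ Cst^-1 bq).
move=> HH; apply: (@le_trans _ _ (\int[mu]_x expR (Cst^-1 * q x))); last first.
  rewrite -ler_ln ?posrE ?expR_gt0// expRK invfM mulrA ler_pdivlMr//.
  by rewrite [leRHS]mulrC.
apply: bm_le_Rintegral.
- apply: bounded_measurable_expR.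
  by under eq_fun do rewrite mulrC; exact: bounded_measurableZ.
- by apply: bounded_measurable_expR; exact: bounded_measurableZ.
- by move=> x; rewrite ler_expR invfM mulrA [leRHS]mulrC ler_pM2r ?invr_gt0.
Qed.

End dual_inequality.

(** * The Gibbs variational principle *)

Section gibbs.
Context {d : measure_display} {T : measurableType d} {R : realType}.
Variables (nu mu : probability T R).
Hypothesis numu : nu `<< mu.

Let rho x := fine (Radon_Nikodym (charge_of_finite_measure nu) mu x).

Let measurable_rho : measurable_fun setT rho.
Proof. by apply: measurableT_comp => //; exact: measurable_fine. Qed.

Lemma le_integral_integrable_left (h F : T -> \bar R) :
  nu.-integrable setT h -> measurable_fun setT F -> (forall x, (h x <= F x)%E) ->
  (\int[nu]_x h x <= \int[nu]_x F x)%E.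
Proof.
move=> ih mF hF; have mh := measurable_int _ ih.
rewrite integralE [leRHS]integralE; apply: leeB; apply: ge0_le_integral => //.
- exact: measurable_funepos.
- exact: measurable_funepos.
- move=> x _; apply: (funepos_le (D := setT)); rewrite ?inE// => y _; exact: hF.
- exact: measurable_funeneg.
- exact: measurable_funeneg.
- move=> x _; apply: (funeneg_le (D := setT)); rewrite ?inE// => y _; exact: hF.
Qed.

(** With u = exp(g - ln Z - ln rho), the inequality 1 + v <= exp v gives g - ln Z + 1 - u <= ln rho
    pointwise, and u has integral at most 1 under [nu]. Bounding ln rho from below by an integrable
    function covers the case of infinite entropy. *)
Lemma gibbs_variational (g : T -> R) : bounded_measurable g ->
  ((\int[nu]_x g x)%R%:E <=
   \int[nu]_x (ln (rho x))%:E + (ln (\int[mu]_x expR (g x)))%R%:E)%E.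
Proof.
move=> bg; have Z0 := Rintegral_expR_gt0 mu bg; set Z := Rintegral _ _ _ in Z0 *.
have mln : measurable_fun setT (fun x => ln (rho x)) by exact: measurableT_comp.
pose u x := expR (g x - ln Z - ln (rho x)).
have mu_ : measurable_fun setT u.
  apply: measurableT_comp => //; apply: measurable_funB => //.
  by apply: measurable_funB => //; case: bg.
have u1 : (\int[nu]_x (u x)%:E <= 1)%E.
  rewrite -(@Radon_Nikodym_SigmaFinite.change_of_variables
    _ _ _ nu mu numu (EFin \o u) setT)//; last 2 first.
    by move=> x; rewrite lee_fin expR_ge0.
    exact/measurable_EFinP.
  have bz : bounded_measurable (fun x => Z^-1 * expR (g x)).
    exact: bounded_measurableZ (bounded_measurable_expR bg).
  have <- : (\int[mu]_x (Z^-1 * expR (g x))%R%:E = 1)%E.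
    by rewrite Rintegral_EFin// bm_RintegralZ ?mulVf ?gt_eqF//; exact: bounded_measurable_expR.
  apply: ae_ge0_le_integral => //.
  - move=> x _; rewrite mule_ge0//; first by rewrite lee_fin expR_ge0.
    exact: Radon_Nikodym_SigmaFinite.f_ge0.
  - apply: emeasurable_funM; first exact/measurable_EFinP.
    exact: measurable_int (Radon_Nikodym_SigmaFinite.f_integrable numu).
  - by move=> x _; rewrite lee_fin mulr_ge0 ?expR_ge0// invr_ge0 ltW.
  - by apply/measurable_EFinP; case: bz.
  - have := @ae_eq_Radon_Nikodym_SigmaFinite _ _ _ nu mu numu setT measurableT.
    apply: filterS => x /(_ I) H _.
    have f0 := Radon_Nikodym_SigmaFinite.f_ge0 numu x.
    have ffin := Radon_Nikodym_SigmaFinite.f_fin_num numu x.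
    rewrite -(fineK ffin) in f0 *.
    have rhoE : rho x = fine (Radon_Nikodym_SigmaFinite.f nu mu x) by rewrite /rho -H.
    rewrite -rhoE in f0 *; rewrite lee_fin in f0.
    rewrite /= -EFinM lee_fin /u.
    (* Where rho vanishes, so does u rho, whatever the default value of ln 0; elsewhere u rho equals
       exp g / Z. *)
    move: f0; rewrite le_eqVlt => /predU1P[<-|r0].
      by rewrite mulr0 mulr_ge0 ?expR_ge0// invr_ge0 ltW.
    rewrite !expRB !lnK ?posrE// divfK ?gt_eqF// mulrC.
    exact: lexx.
have iu : nu.-integrable setT (EFin \o u).
  apply/integrableP; split; first exact/measurable_EFinP.
  under eq_integral => x _ do rewrite gee0_abs ?lee_fin ?expR_ge0//.
  by apply: le_lt_trans u1 _; rewrite ltry.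
have bh : bounded_measurable (fun x => g x + (1 - ln Z)).
  by apply: bounded_measurableD => //; exact: bounded_measurable_cst.
have ih := bounded_measurable_integrable nu bh.
have H : (\int[nu]_x ((g x + (1 - ln Z))%:E - (u x)%:E) <= \int[nu]_x (ln (rho x))%:E)%E.
  apply: le_integral_integrable_left.
  - exact: (integrableB measurableT ih iu).
  - exact/measurable_EFinP.
  - move=> x; rewrite -EFinB lee_fin /u.
    have := expR_ge1Dx (g x - ln Z - ln (rho x)); lra.
move: H; rewrite (integralB measurableT ih iu) (Rintegral_EFin nu bh) => H.
apply: (@le_trans _ _ ((\int[nu]_x (g x + (1 - ln Z)))%R%:E -
  \int[nu]_x (u x)%:E + (ln Z)%:E)%E); last exact: leeD2r.
have ufin : (\int[nu]_x (u x)%:E \is a fin_num)%E by exact: integrable_fin_num.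
rewrite -(fineK ufin) in u1 *; rewrite lee_fin in u1.
rewrite bm_RintegralD//; last exact: bounded_measurable_cst.
rewrite Rintegral_probability_cst -EFinB -EFinD lee_fin; lra.
Qed.

End gibbs.

(** * Kantorovich duality *)

Section hahn_banach.
Context {R : realType} {V : lmodType R}.
Variable D : set V.
Hypotheses (D_0 : D 0) (D_add : forall x y, D x -> D y -> D (x + y)).
Hypothesis D_scale : forall c x, D x -> D (c *: x).

Record sublinear_on (q : V -> R) : Prop := SublinearOn {
  sublinear0 : q 0 = 0 ;
  sublinear_scale : forall c x, 0 < c -> D x -> q (c *: x) <= c * q x ;
  sublinear_add : forall x y, D x -> D y -> q (x + y) <= q x + q y
}.

Let D_opp x : D x -> D (- x).
Proof. by move=> Dx; rewrite -scaleN1r; exact: D_scale. Qed.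

Let sublinearZ q c x : sublinear_on q -> 0 < c -> D x -> q (c *: x) = c * q x.
Proof.
move=> sq c0 Dx; apply/eqP; rewrite eq_le (sublinear_scale sq)//=.
have ci : 0 < c^-1 by rewrite invr_gt0.
have := sublinear_scale sq ci (D_scale c Dx).
rewrite scalerA mulVf ?gt_eqF// scale1r => /(ler_wpM2l (ltW c0)).
by rewrite mulrA divff ?gt_eqF// mul1r.
Qed.

Let sublinear_ge q x : sublinear_on q -> D x -> - q (- x) <= q x.
Proof.
move=> sq Dx; have := sublinear_add sq Dx (D_opp Dx).
by rewrite subrr (sublinear0 sq); lra.
Qed.

Variable p : V -> R.
Hypothesis sp : sublinear_on p.

Let lower (q : V -> R) :=
  [/\ sublinear_on q, forall x, D x -> q x <= p x & forall x, ~ D x -> q x = 0].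

Let lower_ge q x : lower q -> D x -> - p (- x) <= q x.
Proof.
move=> [sq qp _] Dx; apply: le_trans (sublinear_ge sq Dx).
by rewrite lerN2; exact: qp (D_opp Dx).
Qed.

Let p0 (x : V) : R := if `[< D x >] then p x else 0.

Let lower_p0 : lower p0.
Proof.
have p0E x : D x -> p0 x = p x by move=> Dx; rewrite /p0 asboolT.
split; last 2 first.
- by move=> x Dx; rewrite p0E.
- by move=> x Dx; rewrite /p0 asboolF.
split.
- by rewrite p0E// (sublinear0 sp).
- by move=> c x c0 Dx; rewrite !p0E ?(sublinear_scale sp)//; exact: D_scale.
- by move=> x y Dx Dy; rewrite !p0E ?(sublinear_add sp)//; exact: D_add.
Qed.

Let chain_lower (F : set (V -> R)) : (exists q, F q) -> (forall q, F q -> lower q) ->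
  (forall q q', F q -> F q' -> (forall x, q x <= q' x) \/ (forall x, q' x <= q x)) ->
  lower (fun x => inf [set q x | q in F]) /\
  forall q, F q -> forall x, inf [set q x | q in F] <= q x.
Proof.
move=> [q0 Fq0] Flow tot.
have infP x : has_inf [set q x | q in F].
  split; first by exists (q0 x), q0.
  have [Dx|nDx] := pselect (D x).
    by exists (- p (- x)) => _ [q Fq <-]; apply: lower_ge => //; exact: Flow.
  by exists 0 => _ [q Fq <-]; have [_ _ ->] := Flow _ Fq.
have inf_le q x : F q -> inf [set q x | q in F] <= q x.
  by move=> Fq; apply: ge_inf; [case: (infP x)|exists q].
split; last by move=> q Fq x; exact: inf_le.
have inf_eq x c : (forall q, F q -> q x = c) -> inf [set q x | q in F] = c.
  move=> H; apply/eqP; rewrite eq_le -{1}(H _ Fq0) inf_le//=.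
  by apply: lb_le_inf; [case: (infP x)|move=> _ [q Fq <-]; rewrite H].
split.
- split.
  + by apply: inf_eq => q /Flow[sq _ _]; exact: sublinear0.
  + move=> c x c0 Dx; rewrite mulrC -ler_pdivrMr//.
    apply: lb_le_inf; first by case: (infP x).
    move=> _ [q Fq <-]; rewrite ler_pdivrMr// mulrC.
    apply: le_trans (inf_le _ _ Fq) _.
    by have [sq _ _] := Flow _ Fq; exact: sublinear_scale.
  + move=> x y Dx Dy; rewrite -lerBlDr; apply: lb_le_inf; first by case: (infP x).
    move=> _ [q Fq <-]; rewrite lerBlDr -lerBlDl.
    apply: lb_le_inf; first by case: (infP y).
    move=> _ [q' Fq' <-]; rewrite lerBlDl.
    have [qq'|q'q] := tot _ _ Fq Fq'.
    * apply: le_trans (inf_le _ _ Fq) _; have [sq _ _] := Flow _ Fq.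
      by apply: le_trans (sublinear_add sq Dx Dy) _; rewrite lerD2l.
    * apply: le_trans (inf_le _ _ Fq') _; have [sq _ _] := Flow _ Fq'.
      by apply: le_trans (sublinear_add sq Dx Dy) _; rewrite lerD2r.
- move=> x Dx; apply: le_trans (inf_le _ _ Fq0) _.
  by have [_ + _] := Flow _ Fq0; exact.
- by move=> x nDx; apply: inf_eq => q /Flow[_ _]; exact.
Qed.

(* Forcing q to be linear along the ray spanned by e. *)
Let ray_lower q e : lower q -> D e ->
  exists q', [/\ lower q', forall x, q' x <= q x & q' (- e) <= - q e].
Proof.
move=> lq De; have [sq qp qn] := lq.
pose E x := [set q (x + s *: e) - s * q e | s in [set s : R | 0 <= s]].
have qs s : 0 <= s -> q (s *: e) = s * q e.
  rewrite le_eqVlt => /predU1P[<-|s0]; last exact: sublinearZ.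
  by rewrite scale0r mul0r (sublinear0 sq).
have E_inf x : D x -> has_inf (E x).
  move=> Dx; split; first by exists (q (x + 0 *: e) - 0 * q e), 0 => /=.
  exists (- q (- x)) => _ [s /= s0 <-].
  have := sublinear_add sq (D_add Dx (D_scale s De)) (D_opp Dx).
  by rewrite addrAC subrr add0r qs//; lra.
pose q' x := if `[< D x >] then inf (E x) else 0.
have q'E x : D x -> q' x = inf (E x) by move=> Dx; rewrite /q' asboolT.
have q'_le x s : D x -> 0 <= s -> q' x <= q (x + s *: e) - s * q e.
  by move=> Dx s0; rewrite q'E//; apply: ge_inf; [case: (E_inf x Dx)|exists s].
have q'q x : q' x <= q x.
  have [Dx|nDx] := pselect (D x).
    by apply: le_trans (q'_le x 0 Dx (lexx 0)) _; rewrite scale0r addr0 mul0r subr0.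
  by rewrite /q' asboolF// qn.
have q'_ge x c : D x -> (forall s, 0 <= s -> c <= q (x + s *: e) - s * q e) -> c <= q' x.
  move=> Dx H; rewrite q'E//; apply: lb_le_inf; first by case: (E_inf x Dx).
  by move=> _ [s s0 <-]; exact: H.
exists q'; split=> //; last first.
  apply: le_trans (q'_le _ 1 (D_opp De) ler01) _.
  by rewrite scale1r addNr (sublinear0 sq); lra.
split.
- split.
  + apply/eqP; rewrite eq_le; apply/andP; split; first by rewrite -(sublinear0 sq).
    by apply: q'_ge => // s s0; rewrite add0r qs// subrr.
  + move=> c x c0 Dx; rewrite mulrC -ler_pdivrMr//; apply: q'_ge => // s s0.
    rewrite ler_pdivrMr//.
    have cs : 0 <= c * s by rewrite mulr_ge0// ltW.
    apply: le_trans (q'_le _ _ (D_scale c Dx) cs) _.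
    rewrite -scalerA -scalerDr.
    have := sublinear_scale sq c0 (D_add Dx (D_scale s De)); lra.
  + move=> x y Dx Dy; rewrite -lerBlDr; apply: (q'_ge x) => // s s0.
    rewrite lerBlDr -lerBlDl; apply: q'_ge => // t t0; rewrite lerBlDl.
    apply: le_trans (q'_le _ _ (D_add Dx Dy) (addr_ge0 s0 t0)) _.
    rewrite scalerDl addrACA.
    have := sublinear_add sq (D_add Dx (D_scale s De)) (D_add Dy (D_scale t De)); lra.
- by move=> x Dx; exact: le_trans (q'q x) (qp _ Dx).
- by move=> x nDx; rewrite /q' asboolF.
Qed.

(** A minimal sublinear functional below [p] is linear, as otherwise [ray_lower] would lower it.
    Zorn's lemma applies to the reversed pointwise order, a chain being bounded by its infimum. *)
Theorem dominated_linear_functional : exists L : V -> R,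
  [/\ forall x, D x -> L x <= p x,
      forall x y, D x -> D y -> L (x + y) = L x + L y &
      forall c x, D x -> L (c *: x) = c * L x].
Proof.
pose T := {q : V -> R | lower q}.
pose Rel (s t : T) := `[< forall x, sval t x <= sval s x >].
have [|r s t /asboolP rs /asboolP st|s t /asboolP st /asboolP ts|F tot|[q lq] qmin] :=
    @Zorn T Rel.
- by move=> t; apply/asboolP.
- by apply/asboolP => x; exact: le_trans (rs x).
- case: s t st ts => [s ls] [t lt] /= st ts.
  by apply: eq_exist; apply/funext => x; apply/eqP; rewrite eq_le st ts.
- have [[q0 Fq0]|nF] := pselect (exists q, F q); last first.
    by exists (exist _ p0 lower_p0) => s Fs; exfalso; apply: nF; exists s.
  have [|||lF leF] := @chain_lower [set sval q | q in F].
  + by exists (sval q0), q0.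
  + by move=> _ [[q lq] _ <-].
  + move=> _ _ [q Fq <-] [q' Fq' <-].
    by have [/asboolP|/asboolP] := tot _ _ Fq Fq'; [right|left].
  exists (exist _ _ lF) => s Fs; apply/asboolP => x /=.
  by apply: leF; exists s.
have [sq qp _] := lq.
have qN e : D e -> q (- e) = - q e.
  move=> De; have [q' [lq' q'q q'e]] := ray_lower lq De.
  have := qmin (exist _ q' lq'); rewrite /Rel asboolT// => /(_ isT)[] qq'.
  apply/eqP; rewrite eq_le -{1}qq' q'e/=.
  by have := sublinear_ge sq (D_opp De); rewrite opprK; lra.
have qD x y : D x -> D y -> q (x + y) = q x + q y.
  move=> Dx Dy; apply/eqP; rewrite eq_le (sublinear_add sq)//=.
  have := sublinear_add sq (D_add Dx Dy) (D_opp Dy).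
  by rewrite addrK qN//; lra.
exists q; split=> // c x Dx.
have [c0|c0|->] := ltgtP c 0.
- have nc : 0 < - c by lra.
  rewrite -[c in LHS]opprK scaleNr qN; last exact: D_scale.
  by rewrite sublinearZ// mulNr opprK.
- exact: sublinearZ.
- by rewrite scale0r mul0r (sublinear0 sq).
Qed.

End hahn_banach.

(** * A plan on pairs of indices *)

Section discrete_plan.
Context {d : measure_display} {T : measurableType d} {R : realType}.
Variables (nu mu : probability T R) (idx : T -> nat).
Hypothesis idx_measurable : forall n, measurable (idx @^-1` [set n]).

Definition bounded_seq (phi : nat -> R) := exists B, forall n, `|phi n| <= B.

Lemma idx_preimage_measurable (N : set nat) : measurable (idx @^-1` N).
Proof.
have -> : idx @^-1` N = \bigcup_(n in N) idx @^-1` [set n].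
  by apply/seteqP; split => [x Nx|x [n Nn /= ->]//]; exists (idx x).
exact: bigcup_measurable.
Qed.

Lemma bounded_measurable_idx phi : bounded_seq phi -> bounded_measurable (phi \o idx).
Proof.
move=> [B HB]; split; last by exists B => x; exact: HB.
by move=> _ N _; rewrite setTI comp_preimage; exact: idx_preimage_measurable.
Qed.

Variables (c : nat -> nat -> R) (S : R).
Hypothesis c0 : forall i j, 0 <= c i j.
Hypothesis dual : forall phi psi, bounded_seq phi -> bounded_seq psi ->
  (forall i j, phi i - psi j <= c i j) ->
  \int[nu]_x phi (idx x) - \int[mu]_x psi (idx x) <= S.

Let V := (nat * nat)%type -> R^o.
Let D : set V := [set h | exists B, forall z, `|h z| <= B].

Let adm (h : V) (phi psi : nat -> R) (l : R) :=
  [/\ bounded_seq phi, bounded_seq psi, 0 <= l &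
      forall i j, h (i, j) <= phi i + psi j + l * c i j].

Let value (phi psi : nat -> R) (l : R) : R :=
  \int[nu]_x phi (idx x) + \int[mu]_x psi (idx x) + l * S.

(** A superhedging price: the cost of dominating [h] by functions of one index and a multiple of
    [c]. A linear functional below it is positive, has the given marginals, and is at most [S] on
    bounded functions below [c]. The multiplier [l] brings in [c], which may be unbounded and so
    outside [D]. *)
Let price (h : V) : R :=
  inf [set v | exists phi psi l, adm h phi psi l /\ v = value phi psi l].

Let S0 : 0 <= S.
Proof.
have b0 : bounded_seq (fun=> 0) by exists 0 => n; rewrite normr0.
have := dual b0 b0; rewrite !Rintegral_probability_cst subrr; apply => i j.
exact: c0.
Qed.

Let bseq_cst e : bounded_seq (fun=> e). Proof. by exists `|e|. Qed.

Let bseqD phi psi : bounded_seq phi -> bounded_seq psi ->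
  bounded_seq (fun n => phi n + psi n).
Proof.
move=> [B HB] [B' HB']; exists (B + B') => n.
by apply: le_trans (ler_normD _ _) _; apply: lerD.
Qed.

Let bseqZ e phi : bounded_seq phi -> bounded_seq (fun n => e * phi n).
Proof.
by move=> [B HB]; exists (`|e| * B) => n; rewrite normrM ler_wpM2l.
Qed.

Let intD (P : probability T R) phi psi : bounded_seq phi -> bounded_seq psi ->
  \int[P]_x (phi (idx x) + psi (idx x)) = \int[P]_x phi (idx x) + \int[P]_x psi (idx x).
Proof. by move=> b1 b2; apply: bm_RintegralD; exact: bounded_measurable_idx. Qed.

Let intZ (P : probability T R) e phi : bounded_seq phi ->
  \int[P]_x (e * phi (idx x)) = e * \int[P]_x phi (idx x).
Proof. by move=> b1; apply: bm_RintegralZ; exact: bounded_measurable_idx. Qed.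

Let value_ge h B phi psi l : (forall z, `|h z| <= B) -> adm h phi psi l ->
  - B <= value phi psi l.
Proof.
move=> hB [b1 b2 l0 H]; apply/ler_addgt0Pr => e e0.
(* The potentials are divided by this number, which must not vanish when l = 0; the perturbation
   costs at most e. *)
pose k := l + e / (S + 1).
have S1 : 0 < S + 1 by have := S0; lra.
have k0 : 0 < k by rewrite ltr_wpDl// divr_gt0.
have b3 := bseqD b1 (bseq_cst B).
have dk i j : - k^-1 * (phi i + B) - k^-1 * psi j <= c i j.
  rewrite -(ler_pM2l k0).
  have -> : k * (- k^-1 * (phi i + B) - k^-1 * psi j) = - (phi i + B + psi j).
    by field; rewrite gt_eqF.
  have := H i j; have := hB (i, j); rewrite ler_norml => /andP[h1 _] h2.
  have : l * c i j <= k * c i j.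
    by apply: ler_wpM2r => //; rewrite lerDl divr_ge0 ?ltW.
  lra.
have := dual (bseqZ (- k^-1) b3) (bseqZ k^-1 b2) dk.
have iB : \int[nu]_x (phi (idx x) + B) = \int[nu]_x phi (idx x) + B.
  by rewrite (intD nu b1 (bseq_cst B)) Rintegral_probability_cst.
have /= iZ := intZ nu (- k^-1) b3.
rewrite iZ intZ// iB => /(ler_wpM2l (ltW k0)).
set I := Rintegral _ _ _; set J := Rintegral _ _ _.
have -> : k * (- k^-1 * (I + B) - k^-1 * J) = - (I + B + J).
  by field; rewrite gt_eqF.
have : e / (S + 1) * S <= e.
  rewrite mulrAC ler_pdivrMr// ler_pM2l//; lra.
rewrite /value -/I -/J /k; lra.
Qed.

Let price_has_inf h : D h ->
  has_inf [set v | exists phi psi l, adm h phi psi l /\ v = value phi psi l].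
Proof.
move=> [B hB]; split.
  exists (value (fun=> B) (fun=> 0) 0), (fun=> B), (fun=> 0), 0; split => //.
  split=> // i j; rewrite addr0 mul0r addr0.
  exact: le_trans (ler_norm _) (hB _).
by exists (- B) => _ [phi [psi [l [H ->]]]]; exact: value_ge hB H.
Qed.

Let price_le h phi psi l : D h -> adm h phi psi l -> price h <= value phi psi l.
Proof.
move=> Dh H; apply: ge_inf; first by case: (price_has_inf Dh).
by exists phi, psi, l.
Qed.

Let price_ge h v : D h -> (forall phi psi l, adm h phi psi l -> v <= value phi psi l) ->
  v <= price h.
Proof.
move=> Dh H; apply: lb_le_inf; first by case: (price_has_inf Dh).
by move=> _ [phi [psi [l [H' ->]]]]; exact: H.
Qed.

Let D_add x y : D x -> D y -> D (x + y).
Proof.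
move=> [B HB] [B' HB']; exists (B + B') => z.
by apply: le_trans (ler_normD _ _) _; apply: lerD.
Qed.

Let D_scale e x : D x -> D (e *: x).
Proof.
by move=> [B HB]; exists (`|e| * B) => z; rewrite [X in `|X|]/GRing.scale/= normrM ler_wpM2l.
Qed.

Let D_0 : D 0. Proof. by exists 0 => z; rewrite normr0. Qed.

Let price_sublinear : sublinear_on D price.
Proof.
split.
- apply/eqP; rewrite eq_le; apply/andP; split.
    have H : adm 0 (fun=> 0) (fun=> 0) 0 by split=> // i j; rewrite mul0r !addr0.
    apply: le_trans (price_le D_0 H) _.
    by rewrite /value !Rintegral_probability_cst mul0r !addr0.
  apply: (price_ge D_0) => phi psi l H; rewrite -oppr0.
  by apply: value_ge H => z; rewrite normr0.
- move=> e x e0 Dx; rewrite mulrC -ler_pdivrMr//; apply: (price_ge Dx) => phi psi l [b1 b2 l0 H].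
  rewrite ler_pdivrMr//.
  have H' : adm (e *: x) (fun n => e * phi n) (fun n => e * psi n) (e * l).
    split; [exact: bseqZ|exact: bseqZ|by rewrite mulr_ge0// ltW|].
    move=> i j; rewrite -mulrDr -mulrA -mulrDr; apply: ler_wpM2l; first exact: ltW.
    exact: H.
  apply: le_trans (price_le (D_scale e Dx) H') _.
  by rewrite /value !intZ// -mulrA -!mulrDr mulrC.
- move=> x y Dx Dy; rewrite -lerBlDr; apply: (price_ge Dx) => phi psi l [b1 b2 l0 H].
  rewrite lerBlDr -lerBlDl; apply: (price_ge Dy) => phi' psi' l' [b1' b2' l0' H'].
  rewrite lerBlDl.
  have H'' : adm (x + y) (fun n => phi n + phi' n) (fun n => psi n + psi' n) (l + l').
    split; [exact: bseqD|exact: bseqD|exact: addr_ge0|].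
    by move=> i j; apply: le_trans (lerD (H i j) (H' i j)) _; lra.
  apply: le_trans (price_le (D_add Dx Dy) H'') _.
  rewrite /value !intD//; lra.
Qed.

Let ind (N : set nat) : nat -> R := \1_N.

Let indT k : ind setT k = 1.
Proof. by rewrite /ind indicE in_setT. Qed.

Let bseq_ind N : bounded_seq (ind N).
Proof. by exists 1 => n; rewrite /ind indicE; case: (_ \in _); rewrite ?normr1 ?normr0. Qed.

Let int_ind (P : probability T R) N : \int[P]_x ind N (idx x) = fine (P (idx @^-1` N)).
Proof.
have -> : (fun x => ind N (idx x)) = \1_(idx @^-1` N) by apply/funext.
have mN := idx_preimage_measurable N.
by rewrite /Rintegral (integral_indic _ measurableT)// setIT.
Qed.

Let tail_cvg0 (P : probability T R) : fine (P (idx @^-1` ~` `I_n)) @[n --> \oo] --> 0.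
Proof.
have -> : 0 = fine (P set0) by rewrite measure0.
have -> : set0 = \bigcap_n (idx @^-1` ~` `I_n).
  apply/seteqP; split=> // x /(_ (idx x).+1 I) /=; rewrite ltnSn; exact.
have mI n : measurable (idx @^-1` ~` `I_n) by exact: idx_preimage_measurable.
apply: fine_cvg; rewrite fineK; last by apply: fin_num_measure; exact: bigcapT_measurable.
apply: nonincreasing_cvg_mu => //.
- by rewrite -ge0_fin_numE// fin_num_measure.
- exact: bigcapT_measurable.
- move=> m n mn; apply/subsetPset => x /= H; apply: contra_not H.
  by move=> /leq_trans; exact.
Qed.

Let series_squeeze (u : nat -> R) (v : \bar R) (t : nat -> R) : v \is a fin_num ->
  t n @[n --> \oo] --> 0 ->
  (forall n, \sum_(0 <= j < n) u j <= fine v) ->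
  (forall n, fine v - t n <= \sum_(0 <= j < n) u j) ->
  (\sum_(j <oo) (u j)%:E = v)%E.
Proof.
move=> vfin t0 ule uge; apply: cvg_lim => //.
rewrite -(fineK vfin); under eq_fun do rewrite sumEFin.
apply: cvg_EFin; first exact: nearW.
apply: (squeeze_cvgr (f := fun n => fine v - t n) (h := fun=> fine v)).
- by apply: nearW => n; rewrite uge ule.
- by rewrite -[X in _ --> X]subr0; apply: cvgB => //; exact: cvg_cst.
- exact: cvg_cst.
Qed.

Let ind_recr n k : ind `I_n k + ind [set n] k = ind `I_n.+1 k.
Proof.
rewrite /ind !indicE.
have -> : (k \in `I_n.+1) = (k <= n)%N by apply/asboolP/idP.
have -> : (k \in `I_n) = (k < n)%N by apply/asboolP/idP.
have -> : (k \in [set n]) = (k == n) by apply/asboolP/eqP.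
by case: ltngtP => //=; rewrite ?addr0 ?add0r.
Qed.

Let sum_delta (F : nat -> R) n k :
  \sum_(0 <= i < n) F i * ind [set i] k = if (k < n)%N then F k else 0.
Proof.
elim: n => [|n IH]; first by rewrite big_geq.
rewrite big_nat_recr//= IH /ind indicE.
have -> : (k \in [set n]) = (k == n) by apply/asboolP/eqP.
rewrite [in RHS]ltnS; case: (ltngtP k n) => [kn|kn|->] /=.
- by rewrite mulr0 addr0.
- by rewrite mulr0 addr0.
- by rewrite mulr1 add0r.
Qed.

(** The functional given by Hahn-Banach is only finitely additive. The mass of a row beyond column n
    is at most that of all columns from n on, a tail of [mu], which tends to 0; so rows, and
    likewise columns, sum to their full mass. *)
Theorem discrete_plan : exists w : nat -> nat -> R,
  [/\ forall i j, 0 <= w i j,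
      forall i, (\sum_(j <oo) (w i j)%:E = nu (idx @^-1` [set i]))%E,
      forall j, (\sum_(i <oo) (w i j)%:E = mu (idx @^-1` [set j]))%E &
      (\sum_(i <oo) \sum_(j <oo) (w i j * c i j)%:E <= S%:E)%E].
Proof.
have [L [Lp LD LZ]] := dominated_linear_functional D_0 D_add D_scale price_sublinear.
have Lle h phi psi l : D h -> adm h phi psi l -> L h <= value phi psi l.
  by move=> Dh H; apply: le_trans (Lp _ Dh) (price_le Dh H).
have val0 : value (fun=> 0) (fun=> 0) 0 = 0.
  by rewrite /value !Rintegral_probability_cst mul0r !addr0.
have LN h : D h -> L (- h) = - L h by move=> Dh; rewrite -scaleN1r LZ// mulN1r.
have L_ge0 h : D h -> (forall z, 0 <= h z) -> 0 <= L h.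
  move=> Dh h0; rewrite -oppr_le0 -LN// -val0; apply: Lle.
    by rewrite -scaleN1r; exact: D_scale.
  by split=> // i j; rewrite mul0r !addr0 oppr_le0.
have L_mono h h' : D h -> D h' -> (forall z, h z <= h' z) -> L h <= L h'.
  move=> Dh Dh' hh'; rewrite -subr_ge0 -LN// -LD//; last first.
    by rewrite -scaleN1r; exact: D_scale.
  apply: L_ge0; first by apply: D_add => //; rewrite -scaleN1r; exact: D_scale.
  by move=> z; rewrite subr_ge0.
pose rect (M N : set nat) : V := fun z => ind M z.1 * ind N z.2.
have Drect M N : D (rect M N).
  exists 1 => z; rewrite /rect /ind !indicE.
  by do 2 case: (_ \in _); rewrite ?mulr1 ?mulr0 ?normr1 ?normr0.
have rect_ge0 M N z : 0 <= rect M N z by rewrite /rect /ind !indicE mulr_ge0.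
have ind01 N k : 0 <= ind N k <= 1.
  by rewrite /ind indicE; case: (_ \in _); rewrite ?lexx ?ler01.
have rect_le M N M' N' z : M `<=` M' -> N `<=` N' -> rect M N z <= rect M' N' z.
  have ind_le (B B' : set nat) k : B `<=` B' -> ind B k <= ind B' k.
    move=> BB'; rewrite /ind !indicE; have [kB|kB] := boolP (k \in B); last by [].
    by rewrite (mem_set (BB' _ (set_mem kB))).
  move=> MM' NN'; apply: ler_pM; try exact: ind_le.
    by case/andP: (ind01 M z.1).
  by case/andP: (ind01 N z.2).
pose w i j := L (rect [set i] [set j]).
have row M : L (rect M setT) = fine (nu (idx @^-1` M)).
  apply/eqP; rewrite eq_le; apply/andP; split.
    rewrite -int_ind; have H : adm (rect M setT) (ind M) (fun=> 0) 0.
      by split=> // i j; rewrite mul0r !addr0 /rect /= indT mulr1.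
    apply: le_trans (Lle _ _ _ _ (Drect _ _) H) _.
    by rewrite /value Rintegral_probability_cst mul0r !addr0.
  rewrite -lerN2 -LN// -int_ind.
  have H : adm (- rect M setT) (fun n => (-1) * ind M n) (fun=> 0) 0.
    split=> //; first exact: bseqZ.
    by move=> i j; rewrite mul0r !addr0 mulN1r lerN2 /rect /= indT mulr1.
  have DN : D (- rect M setT) by rewrite -scaleN1r; exact: D_scale.
  apply: le_trans (Lle _ _ _ _ DN H) _.
  by rewrite /value Rintegral_probability_cst mul0r !addr0 intZ// mulN1r.
have col N : L (rect setT N) = fine (mu (idx @^-1` N)).
  apply/eqP; rewrite eq_le; apply/andP; split.
    rewrite -int_ind; have H : adm (rect setT N) (fun=> 0) (ind N) 0.
      by split=> // i j; rewrite mul0r addr0 add0r /rect /= indT mul1r.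
    apply: le_trans (Lle _ _ _ _ (Drect _ _) H) _.
    by rewrite /value Rintegral_probability_cst mul0r addr0 add0r.
  rewrite -lerN2 -LN// -int_ind.
  have H : adm (- rect setT N) (fun=> 0) (fun n => (-1) * ind N n) 0.
    split=> //; first exact: bseqZ.
    by move=> i j; rewrite mul0r addr0 add0r mulN1r lerN2 /rect /= indT mul1r.
  have DN : D (- rect setT N) by rewrite -scaleN1r; exact: D_scale.
  apply: le_trans (Lle _ _ _ _ DN H) _.
  by rewrite /value Rintegral_probability_cst mul0r addr0 add0r intZ// mulN1r.
have I0 : `I_0 = set0 by apply/seteqP; split.
have rowsum i n : \sum_(0 <= j < n) w i j = L (rect [set i] `I_n).
  elim: n => [|n IH].
    rewrite big_geq//; have -> : rect [set i] `I_0 = 0 *: rect [set i] `I_0.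
      by apply/funext => z; rewrite I0 /rect /ind indic0 mulr0 scale0r.
    by rewrite LZ// mul0r.
  rewrite big_nat_recr//= IH /w -LD//; congr L; apply/funext => z.
  by rewrite [LHS]/GRing.add/= /rect -mulrDr ind_recr.
have colsum j n : \sum_(0 <= i < n) w i j = L (rect `I_n [set j]).
  elim: n => [|n IH].
    rewrite big_geq//; have -> : rect `I_0 [set j] = 0 *: rect `I_0 [set j].
      by apply/funext => z; rewrite I0 /rect /ind indic0 mul0r scale0r.
    by rewrite LZ// mul0r.
  rewrite big_nat_recr//= IH /w -LD//; congr L; apply/funext => z.
  by rewrite [LHS]/GRing.add/= /rect -mulrDl ind_recr.
exists w; split.
- by move=> i j; exact: L_ge0.
- move=> i; apply: (series_squeeze (t := fun n => fine (mu (idx @^-1` ~` `I_n)))).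
  + exact: fin_num_measure.
  + exact: tail_cvg0.
  + by move=> n; rewrite rowsum -row; apply: L_mono => // z; exact: rect_le.
  + move=> n; rewrite rowsum -row -col lerBlDr -LD//; apply: L_mono => //; first exact: D_add.
    move=> z; rewrite [leRHS]/GRing.add/= /rect /ind !indicE !in_setT in_setC.
    by do 2 case: (_ \in _); rewrite /= ?mul1r ?mul0r ?add0r ?addr0 ?mulr1 ?ler01.
- move=> j; apply: (series_squeeze (t := fun n => fine (nu (idx @^-1` ~` `I_n)))).
  + exact: fin_num_measure.
  + exact: tail_cvg0.
  + by move=> n; rewrite colsum -col; apply: L_mono => // z; exact: rect_le.
  + move=> n; rewrite colsum -col -row lerBlDr -LD//; apply: L_mono => //; first exact: D_add.
    move=> z; rewrite [leRHS]/GRing.add/= /rect /ind !indicE !in_setT in_setC.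
    by do 2 case: (_ \in _); rewrite /= ?mul1r ?mul0r ?add0r ?addr0 ?mulr1 ?ler01.
- have a0 i j : (0 <= (w i j * c i j)%:E)%E by rewrite lee_fin mulr_ge0//; exact: L_ge0.
  apply: lime_le; first by apply: is_cvg_nneseries => i _ _; exact: nneseries_ge0.
  apply: nearW => n.
  rewrite -nneseries_sum; last by [].
  apply: lime_le; first by apply: is_cvg_nneseries => i _ _; exact: sume_ge0.
  apply: nearW => m.
  under eq_bigr do rewrite sumEFin.
  rewrite sumEFin lee_fin.
  (* The restriction of [c] to a finite block is bounded, hence in [D], and below [c], so its value
     is at most [S]. *)
  pose h : V := \sum_(0 <= j < m) \sum_(0 <= i < n) c i j *: rect [set i] [set j].
  have LS k (g : nat -> V) : (forall i, D (g i)) ->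
      D (\sum_(0 <= i < k) g i) /\ L (\sum_(0 <= i < k) g i) = \sum_(0 <= i < k) L (g i).
    move=> Dg; elim: k => [|k [IH1 IH2]].
      rewrite !big_geq//; split => //.
      by rewrite -(scale0r (0 : V)) LZ// mul0r.
    by rewrite !big_nat_recr//= LD// IH2; split => //; exact: D_add.
  have Dj j : D (\sum_(0 <= i < n) c i j *: rect [set i] [set j]).
    by apply LS => i; exact: D_scale.
  have [Dh Lh] := LS m _ Dj.
  have -> : \sum_(0 <= j < m) \sum_(0 <= i < n) w i j * c i j = L h.
    rewrite Lh; apply: eq_bigr => j _.
    have [_ ->] := LS n (fun i => c i j *: rect [set i] [set j]) (fun i => D_scale _ (Drect _ _)).
    by apply: eq_bigr => i _; rewrite LZ// mulrC.
  have valS : value (fun=> 0) (fun=> 0) 1 = S.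
    by rewrite /value !Rintegral_probability_cst mul1r !add0r.
  rewrite -valS; apply: Lle => //; split => // i j; rewrite mul1r !add0r.
  rewrite /h fct_sumE; under eq_bigr do rewrite fct_sumE.
  rewrite (eq_bigr (fun j0 => (if (i < n)%N then c i j0 else 0) * ind [set j0] j)); last first.
    move=> j0 _; rewrite -(sum_delta (fun i => c i j0)) mulr_suml.
    by apply: eq_bigr => i0 _; exact: mulrA.
  rewrite (sum_delta (fun j0 => if (i < n)%N then c i j0 else 0)).
  by do 2 case: ifP => // _; exact: c0.
Qed.

End discrete_plan.

(** * From a discrete plan to a coupling *)

Section plan_coupling.
Context {d : measure_display} {T : measurableType d} {R : realType}.
Variables (nu mu : probability T R) (idx : T -> nat).
Hypothesis idx_measurable : forall n, measurable (idx @^-1` [set n]).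
Variable w : nat -> nat -> R.
Hypothesis w0 : forall i j, 0 <= w i j.
Hypothesis row : forall i, (\sum_(j <oo) (w i j)%:E = nu (idx @^-1` [set i]))%E.
Hypothesis col : forall j, (\sum_(i <oo) (w i j)%:E = mu (idx @^-1` [set j]))%E.

Let cell n := idx @^-1` [set n].
Let cell_measurable n : measurable (cell n). Proof. exact: idx_measurable. Qed.
#[local] Hint Resolve cell_measurable : core.

Let m (P : probability T R) n : R := fine (P (cell n)).

Let mE (P : probability T R) n : P (cell n) = (m P n)%:E.
Proof. by rewrite fineK//; exact: fin_num_measure. Qed.

Let m_ge0 P n : 0 <= m P n. Proof. exact: fine_ge0. Qed.

Let rect_measurable i j : measurable (cell i `*` cell j).
Proof. exact: measurableX. Qed.

(** On a null cell the quotient is 0 by convention; the row and column sums force [w i j = 0] there,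
    so [densE] holds without exception. *)
Let dens i j : R := w i j / (m nu i * m mu j).

Let dens_ge0 i j : 0 <= dens i j.
Proof. by rewrite divr_ge0// mulr_ge0. Qed.

Definition plan_coupling : set (T * T) -> \bar R :=
  mseries (fun i => mseries (fun j =>
    mscale (NngNum (dens_ge0 i j)) (mrestr (nu \x mu)%E (rect_measurable i j))) 0) 0.

HB.instance Definition _ := Measure.on plan_coupling.

Let plan_couplingE E : plan_coupling E =
  (\sum_(i <oo) \sum_(j <oo) (dens i j)%:E * (nu \x mu)%E (E `&` (cell i `*` cell j)))%E.
Proof. by []. Qed.

Let w_le_row i j : w i j <= m nu i.
Proof.
rewrite -lee_fin -mE -row; apply: le_trans (nneseries_lim_ge j.+1 _) => /=; last first.
  by move=> k _ _; rewrite lee_fin.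
by rewrite big_nat_recr//= leeDr// sume_ge0// => k _; rewrite lee_fin.
Qed.

Let w_le_col i j : w i j <= m mu j.
Proof.
rewrite -lee_fin -mE -col; apply: le_trans (nneseries_lim_ge i.+1 _) => /=; last first.
  by move=> k _ _; rewrite lee_fin.
by rewrite big_nat_recr//= leeDr// sume_ge0// => k _; rewrite lee_fin.
Qed.

Let w_eq0 i j : m nu i * m mu j = 0 -> w i j = 0.
Proof.
move=> /eqP; rewrite mulf_eq0 => /orP[]/eqP H; apply/eqP; rewrite eq_le w0 andbT -H.
  exact: w_le_row.
exact: w_le_col.
Qed.

Let densE i j : dens i j * (m nu i * m mu j) = w i j.
Proof.
have [H|H] := eqVneq (m nu i * m mu j) 0; first by rewrite H mulr0 w_eq0.
by rewrite divfK.
Qed.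

Let partition_measure (P : probability T R) A : measurable A ->
  (\sum_(i <oo) P (A `&` cell i) = P A)%E.
Proof.
move=> mA; have -> : A = \bigcup_i (A `&` cell i).
  by apply/seteqP; split=> [x Ax|x [i _ []]//]; exists (idx x).
rewrite measure_semi_bigcup//.
- apply: eq_eseriesr => i _; congr (P _); apply/seteqP.
  by split => [x [[? _ [? ?]] ?]|x [Ax ix]] //; split=> //; exists i.
- by move=> i; exact: measurableI.
- apply/trivIsetP => i j _ _ /eqP ij; apply/seteqP; split => // x [[_ +] [_ +]].
  by rewrite /cell/= => -> /ij.
- by apply: bigcup_measurable => i _; exact: measurableI.
Qed.

(** [a] is the conditional probability of [A] given the cell, 0 on a null cell. As a factor it
    leaves the inner series, which then sums to the mass of the cell. *)
Let marginal_aux (P : probability T R) A i : measurable A ->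
  exists2 a : R, 0 <= a & P (A `&` cell i) = (a * m P i)%:E.
Proof.
move=> mA; have Pfin : P (A `&` cell i) \is a fin_num.
  by apply: fin_num_measure; exact: measurableI.
exists (fine (P (A `&` cell i)) / m P i); first by rewrite divr_ge0// fine_ge0.
have [H|H] := eqVneq (m P i) 0; last by rewrite divfK// fineK.
rewrite H mulr0; apply/eqP; rewrite eq_le measure_ge0 andbT.
have : (P (A `&` cell i) <= P (cell i))%E.
  by apply: le_measure; rewrite ?inE//; exact: measurableI.
by rewrite mE H.
Qed.

Let plan_coupling_fst A : measurable A -> plan_coupling (fst @^-1` A) = nu A.
Proof.
move=> mA; rewrite plan_couplingE -(partition_measure nu mA); apply: eq_eseriesr => i _.
have [a a0 aE] := marginal_aux nu i mA.
rewrite (@eq_eseriesr _ _ (fun j => (a%:E * (w i j)%:E)%E)); last first.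
  move=> j _.
  have -> : fst @^-1` A `&` (cell i `*` cell j) = (A `&` cell i) `*` cell j.
    by apply/seteqP; split=> [[x y]/= [? [? ?]]|[x y]/= [[? ?] ?]].
  rewrite product_measure1E//; last exact: measurableI.
  by rewrite [X in (_ * (X * _))%E]aE [X in (_ * (_ * X))%E]mE -!EFinM -densE; congr EFin; ring.
rewrite nneseriesZl; last by move=> j _; rewrite lee_fin.
by rewrite row [X in (_ * X)%E]mE aE EFinM.
Qed.

Let plan_coupling_snd A : measurable A -> plan_coupling (snd @^-1` A) = mu A.
Proof.
move=> mA; rewrite plan_couplingE nneseries_interchange; last first.
  by move=> i j; rewrite mule_ge0// lee_fin.
rewrite -(partition_measure mu mA); apply: eq_eseriesr => j _.
have [a a0 aE] := marginal_aux mu j mA.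
rewrite (@eq_eseriesr _ _ (fun i => (a%:E * (w i j)%:E)%E)); last first.
  move=> i _.
  have -> : snd @^-1` A `&` (cell i `*` cell j) = cell i `*` (A `&` cell j).
    by apply/seteqP; split=> [[x y]/= [? [? ?]]|[x y]/= [? [? ?]]].
  rewrite product_measure1E//; last exact: measurableI.
  by rewrite [X in (_ * (_ * X))%E]aE [X in (_ * (X * _))%E]mE -!EFinM -densE; congr EFin; ring.
rewrite nneseriesZl; last by move=> i _; rewrite lee_fin.
by rewrite col [X in (_ * X)%E]mE aE EFinM.
Qed.

Let plan_coupling_setT : plan_coupling setT = 1%E.
Proof. by rewrite -(preimage_setT fst) plan_coupling_fst// probability_setT. Qed.

HB.instance Definition _ := Measure_isProbability.Build _ _ _ plan_coupling plan_coupling_setT.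

Let cost_measurable (F : nat -> nat -> R) :
  measurable_fun setT (fun z : T * T => (F (idx z.1) (idx z.2))%:E).
Proof.
apply/measurable_EFinP => _ B mB; rewrite setTI.
have -> : (fun z : T * T => F (idx z.1) (idx z.2)) @^-1` B =
  \bigcup_i \bigcup_(j in [set j | B (F i j)]) (cell i `*` cell j).
  apply/seteqP; split=> [[x y]/= H|[x y] [i _ [j /= H [/= xi yj]]]].
    by exists (idx x) => //; exists (idx y).
  by rewrite xi yj.
by apply: bigcup_measurable => i _; apply: bigcup_measurable => j _; exact: rect_measurable.
Qed.

Let integral_plan_coupling (F : nat -> nat -> R) : (forall i j, 0 <= F i j) ->
  (\int[plan_coupling]_z (F (idx z.1) (idx z.2))%:E =
   \sum_(i <oo) \sum_(j <oo) (w i j * F i j)%:E)%E.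
Proof.
move=> F0; have mF := cost_measurable F.
rewrite ge0_integral_measure_series//; last by move=> z _; rewrite lee_fin.
apply: eq_eseriesr => i _; rewrite ge0_integral_measure_series//; last first.
  by move=> z _; rewrite lee_fin.
apply: eq_eseriesr => j _; rewrite ge0_integral_mscale//; last first.
  by move=> z _; rewrite lee_fin.
rewrite /= (@ae_eq_integral _ _ _ _ _ (cst (F i j)%:E))//; last first.
  exists (~` (cell i `*` cell j)); split.
  - exact: measurableC.
  - by rewrite /= /mrestr setICl measure0.
  - by move=> [x y] /= H [/= xi yj]; apply: H => _; rewrite xi yj.
rewrite integral_cst//= /mrestr setTI product_measure1E//.
rewrite [X in (_ * (_ * (X * _)))%E]mE [X in (_ * (_ * (_ * X)))%E]mE -!EFinM.
congr EFin.
by rewrite -densE; ring.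
Qed.

Theorem plan_coupling_exists : exists pi : probability (T * T)%type R,
  [/\ forall A, measurable A -> pi (fst @^-1` A) = nu A,
      forall A, measurable A -> pi (snd @^-1` A) = mu A &
      forall F : nat -> nat -> R, (forall i j, 0 <= F i j) ->
        (\int[pi]_z (F (idx z.1) (idx z.2))%:E =
         \sum_(i <oo) \sum_(j <oo) (w i j * F i j)%:E)%E].
Proof.
exists plan_coupling; split.
- exact: plan_coupling_fst.
- exact: plan_coupling_snd.
- exact: integral_plan_coupling.
Qed.

End plan_coupling.

Section kantorovich.
Context {d : measure_display} {R : realType}.
Variable X : completeBorelMetricType d R.

Lemma open_measurable_borel (U : set X) : open U -> measurable U.
Proof. by move=> oU; rewrite borel_measurableE; exact: sub_sigma_algebra. Qed.

Lemma metric_ball_open (x : X) (e : R) : open (ball x e).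
Proof.
rewrite openE => y; rewrite ballEmdist/= => xy.
have d0 : 0 < e - mdist x y by rewrite subr_gt0.
apply: filterS (nbhsx_ballx y _ d0) => z; rewrite !ballEmdist/= => yz.
by have := metric_triangle x y z; lra.
Qed.

(** Each point goes to the least index of a centre within e, so that a cell is a ball minus finitely
    many earlier balls, hence Borel. When [n] codes no element of [D], [c n] is a default point, as
    admissible a centre as any other. *)
Lemma separable_cells (e : R) : separable X -> 0 < e ->
  exists (idx : X -> nat) (c : nat -> X),
    (forall n, measurable (idx @^-1` [set n])) /\ forall x, mdist (c (idx x)) x < e.
Proof.
move=> [D cD dD] e0; have [f finj] := countable_injP D cD.
pose c n := xget (point : X) [set x | D x /\ f x = n].
have cover x : exists n, `[< mdist (c n) x < e >].
  have [y [yx Dy]] := dD (ball x e)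
    (ex_intro _ x (@ball_center _ _ x (PosNum e0))) (@metric_ball_open x e).
  exists (f y); apply/asboolP; rewrite /c.
  have [Dz fz] : [set z | D z /\ f z = f y] (xget point [set z | D z /\ f z = f y]).
    by apply: xgetPex; exists y.
  have -> : xget point [set z | D z /\ f z = f y] = y.
    by apply: finj; rewrite ?inE.
  by rewrite metric_sym; move: yx; rewrite ballEmdist.
pose idx x := ex_minn (cover x).
exists idx, c; split; last by move=> x; rewrite /idx; case: ex_minnP => n /asboolP.
move=> n.
have -> : idx @^-1` [set n] = ball (c n) e `\` \bigcup_(k in `I_n) ball (c k) e.
  apply/seteqP; split=> x; rewrite /idx /=.
    case: ex_minnP => k /asboolP kx kmin <-; split; first by rewrite ballEmdist.
    move=> [l /= lk]; rewrite ballEmdist/= => /asboolP/kmin; rewrite leqNgt lk//.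
  move=> [+ H]; rewrite ballEmdist/= => cx; case: ex_minnP => k /asboolP kx kmin.
  apply/eqP; rewrite eqn_leq kmin ?asboolT//= leqNgt; apply/negP => kn; apply: H.
  by exists k => //; rewrite ballEmdist.
have mball k : measurable (ball (c k) e) by apply: open_measurable_borel; exact: metric_ball_open.
by apply: measurableD => //; apply: bigcup_measurable => k _.
Qed.

Variables (nu mu : probability X R) (al : R -> R).
Hypotheses (Y : young_function al) (D2 : delta2 al) (sep : separable X).

(** The oscillation of an unbounded cost on small cells need not be uniformly small. Convexity and
    the Delta_2-condition turn a small shift of the distance into a factor [a] close to 1 and a
    small constant [b]. *)
Lemma transport_cost_le_dual (S : R) :
  (forall phi psi : X -> R, bounded_measurable phi -> bounded_measurable psi ->
    (forall x y, phi x - psi y <= al (mdist x y)) ->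
    \int[nu]_x phi x - \int[mu]_x psi x <= S) ->
  (transport_cost al nu mu <= S%:E)%E.
Proof.
move=> dual; have C := young_convex_cost Y; have [K K0 HK] := D2.
have S0 : 0 <= S.
  have b0 := @bounded_measurable_cst _ X R 0.
  have := dual _ _ b0 b0; rewrite !Rintegral_probability_cst subrr; apply => x y.
  exact: (cost_ge0 C).
have al2 : 0 <= al 2 := cost_ge0 C _.
apply/lee_addgt0Pr => eta eta0.
(* The discretized bound is a S + b = S + dl (K S + al 2), so dl L <= eta keeps the excess below
   eta. *)
pose L := K * S + al 2 + 1.
have L0 : 0 < L by have := mulr_ge0 (ltW K0) S0; rewrite /L; lra.
pose dl := Num.min 1 (eta / L).
have dl0 : 0 < dl by rewrite lt_min ltr01 divr_gt0.
have dl1 : dl <= 1 by rewrite ge_min lexx.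
have dlL : dl * L <= eta by rewrite -ler_pdivlMr// ge_min lexx orbT.
pose a := 1 + dl * K; pose b := dl * al 2.
have a0 : 0 < a by have := mulr_gt0 dl0 K0; rewrite /a; lra.
have shift u : 0 <= u -> al (u + dl) <= a * al u + b.
  move=> u0; have := @cost_conv _ _ C dl (u + 1) u (ltW dl0) dl1.
  have -> : dl * (u + 1) + (1 - dl) * u = u + dl by ring.
  move=> /le_trans; apply.
  have u1 : al (u + 1) <= K * al u + al 2.
    have au := cost_ge0 C u; have Kau := mulr_ge0 (ltW K0) au.
    have [ul|ul] := leP u 1.
      by apply: le_trans (cost_mono C _ (_ : u + 1 <= 2)) _; lra.
    apply: le_trans (cost_mono C _ (_ : u + 1 <= 2 * u)) _; [lra|lra|].
    by have := HK u; lra.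
  have := ler_wpM2l (ltW dl0) u1; have := mulr_ge0 (ltW dl0) (cost_ge0 C u).
  rewrite /a /b; lra.
(* Points are within dl / 4 of their centres, so distances between centres are off by at most dl /
   2: [u] lies below the true distance, and [u + dl] above it. *)
have [idx [c [midx cidx]]] := separable_cells sep (ltac:(lra) : 0 < dl / 4).
pose u i j := Num.max (mdist (c i) (c j) - dl / 2) 0.
have u0 i j : 0 <= u i j by rewrite le_max lexx orbT.
pose F i j := a * al (u i j) + b.
have F0 i j : 0 <= F i j.
  by rewrite addr_ge0// mulr_ge0 ?(ltW a0) ?(ltW dl0)//; exact: (cost_ge0 C).
have tri x y : mdist (c (idx x)) (c (idx y)) - dl / 2 <= mdist x y /\
    mdist x y <= mdist (c (idx x)) (c (idx y)) + dl / 2.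
  have := cidx x; have := cidx y.
  have := metric_triangle (c (idx x)) x (c (idx y)).
  have := metric_triangle x y (c (idx y)).
  have := metric_triangle x (c (idx x)) y.
  have := metric_triangle (c (idx x)) (c (idx y)) y.
  rewrite (metric_sym y) (metric_sym x (c (idx x))); lra.
have lower x y : al (u (idx x) (idx y)) <= al (mdist x y).
  apply: (cost_mono C) => //; rewrite ge_max mdist_ge0 andbT.
  by case: (tri x y).
have upper x y : al (mdist x y) <= F (idx x) (idx y).
  apply: le_trans (shift _ (u0 _ _)); apply: (cost_mono C); first exact: mdist_ge0.
  have [_] := tri x y; have : mdist (c (idx x)) (c (idx y)) - dl / 2 <= u (idx x) (idx y).
    by rewrite le_max lexx.
  lra.
have [|w [w0 row col cost]] := @discrete_plan _ _ _ nu mu idx midx F (a * S + b) F0.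
  move=> phi psi bphi bpsi H.
  have bphi' := bounded_measurable_idx midx bphi.
  have bpsi' := bounded_measurable_idx midx bpsi.
  (* Subtracting b and dividing by a turns potentials for [F] into potentials for al(u), which is
     below the true cost. *)
  have b1 := bounded_measurableD bphi' (@bounded_measurable_cst _ X R (- b)).
  have := dual _ _ (bounded_measurableZ a^-1 b1) (bounded_measurableZ a^-1 bpsi').
  rewrite !bm_RintegralZ// bm_RintegralD//; last exact: bounded_measurable_cst.
  rewrite Rintegral_probability_cst /= => H'.
  have {}H' : a^-1 * (\int[nu]_x phi (idx x) - b) - a^-1 * \int[mu]_x psi (idx x) <= S.
    apply: H' => x y; apply: le_trans (lower x y).
    rewrite -mulrBr mulrC ler_pdivrMr//; have := H (idx x) (idx y); rewrite /F; lra.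
  move: H'; rewrite -mulrBr mulrC ler_pdivrMr//; lra.
have [pi [pi1 pi2 piF]] := plan_coupling_exists midx w0 row col.
apply: (@le_trans _ _ (\int[pi]_z (al (mdist z.1 z.2))%:E)%E).
  apply: ereal_inf_lbound; exists pi => // B mB.
  by split; [exact: pi1|exact: pi2].
apply: (@le_trans _ _ (\int[pi]_z (F (idx z.1) (idx z.2))%:E)%E).
  apply: ge0_le_integral_nonmeasurable => z; rewrite lee_fin.
    exact: (cost_ge0 C).
  exact: upper.
rewrite piF//; apply: le_trans cost _; rewrite -EFinD lee_fin /a /b.
have := mulr_ge0 (ltW K0) S0; move: dlL; rewrite /L; lra.
Qed.

End kantorovich.

(** * The transport-entropy inequality *)

Section transport_entropy_inequality.
Context {d : measure_display} {R : realType}.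
Variable X : completeBorelMetricType d R.
Variable mu : probability X R.
Variables (al : R -> R).
Hypotheses (Y : young_function al) (D2 : delta2 al) (sep : separable X).
Local Notation p := (p_exponent al).

(** The Gibbs principle at phi / (k^p C) bounds every dual pair by the entropy with a loss k^p,
    which is removed as k tends to 1 once the entropy is finite. *)
Lemma transport_entropy_of_exp_integral (C : R) : 0 < C ->
  (forall (k : R) (phi psi : X -> R), 1 < k ->
    bounded_measurable phi -> bounded_measurable psi ->
    (forall x y, phi x - psi y <= al (mdist x y)) ->
    \int[mu]_x expR (phi x / (k `^ p * C)) <=
    expR (\int[mu]_x psi x / (k `^ p * C))) ->
  transport_entropy al mu C.
Proof.
move=> C0 H nu; have p1 := p_exponent_gt1 Y D2.
rewrite /relative_entropy; case: asboolP => [numu|_]; last first.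
  by rewrite gt0_muley ?lte_fin// leey.
set E := (\int[nu]_x _)%E.
have key (k : R) (phi psi : X -> R) : 1 < k ->
    bounded_measurable phi -> bounded_measurable psi ->
    (forall x y, phi x - psi y <= al (mdist x y)) ->
    (((\int[nu]_x phi x - \int[mu]_x psi x) / (k `^ p * C))%R%:E <= E)%E.
  move=> k1 bphi bpsi Hpp; have kC0 : 0 < k `^ p * C by rewrite mulr_gt0// powR_gt0//; lra.
  set g := fun x => (k `^ p * C)^-1 * phi x.
  have bg : bounded_measurable g by exact: bounded_measurableZ.
  have := gibbs_variational numu bg; rewrite -/E => G.
  have Z0 := Rintegral_expR_gt0 mu bg.
  have lnZ : ln (\int[mu]_x expR (g x)) <= \int[mu]_x psi x / (k `^ p * C).
    rewrite -ler_expR lnK ?posrE//.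
    have -> : \int[mu]_x expR (g x) = \int[mu]_x expR (phi x / (k `^ p * C)).
      by apply: eq_Rintegral => x _; rewrite /g mulrC.
    exact: H.
  have intg : \int[nu]_x g x = (\int[nu]_x phi x) / (k `^ p * C).
    by rewrite bm_RintegralZ// mulrC.
  rewrite mulrBl EFinB leeBlDr//; rewrite intg in G; apply: le_trans G _.
  by apply: leeD2l; rewrite lee_fin.
have b0 := @bounded_measurable_cst _ X R 0.
have c0 : forall x y : X, (0 : R) - 0 <= al (mdist x y).
  by move=> x y; rewrite subrr; exact: young_ge0.
(* Zero potentials show that the entropy is nonnegative, which excludes -oo. *)
have E0 : (0 <= E)%E.
  have := key 2 _ _ (ltac:(lra) : 1 < (2 : R)) b0 b0 c0.
  by rewrite !Rintegral_probability_cst subrr mul0r.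
case: E key E0 => [h| |]// key h0; last by rewrite gt0_muley ?lte_fin// leey.
rewrite -EFinM; apply: (transport_cost_le_dual Y D2 sep) => phi psi bphi bpsi Hpp.
rewrite lee_fin in h0; have Ch : 0 <= C * h by rewrite mulr_ge0// ltW.
apply/ler_addgt0Pr => e e0.
(* With k^p = 1 + eta the loss is eta C h <= e. *)
pose eta := e / (C * h + 1).
have eta0 : 0 < eta by rewrite divr_gt0//; lra.
pose k := (1 + eta) `^ p^-1.
have k1 : 1 < k.
  have : 1 `^ p^-1 < (1 + eta) `^ p^-1.
    by apply: gt0_ltr_powR; rewrite ?nnegrE ?invr_gt0; lra.
  by rewrite powR1.
have kp : k `^ p = 1 + eta.
  by rewrite -powRrM mulVf ?powRr1 ?gt_eqF//; lra.
have := key k phi psi k1 bphi bpsi Hpp; rewrite lee_fin kp.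
have e1 : 0 < (1 + eta) * C by rewrite mulr_gt0//; lra.
rewrite ler_pdivrMr// => /le_trans; apply.
have : eta * (C * h + 1) = e by rewrite /eta divfK// gt_eqF//; lra.
lra.
Qed.

(** Monotonicity in the constant rests on a nonnegative entropy, and the inequality itself provides
    it since transport costs are nonnegative. *)
Lemma transport_entropy_le (C C' : R) : 0 < C -> C <= C' ->
  transport_entropy al mu C -> transport_entropy al mu C'.
Proof.
move=> C0 CC' H nu; apply: le_trans (H nu) _.
apply: lee_wpmul2r; last by rewrite lee_fin.
have : (0 <= C%:E * relative_entropy nu mu)%E.
  apply: le_trans (H nu); apply: le_ereal_inf_tmp => _ [pi _ <-].
  by apply: integral_ge0 => z _; rewrite lee_fin; exact: young_ge0.
by rewrite pmule_rge0 ?lte_fin.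
Qed.

End transport_entropy_inequality.

Theorem theorem1p7 (R : realType) (d : measure_display)
    (X : completeBorelMetricType d R)
    (X_separable : separable X) (X_proper : compact_closed_balls X)
    (mu : probability X R) (alpha : R -> R)
    (alpha_young : young_function alpha) (alpha_delta2 : delta2 alpha) :
  let r := r_exponent alpha in
  let p := p_exponent alpha in
  [/\ 1 <= r, r <= p, 1 < p,
      forall A : R, 0 < A -> LSI_plus alpha mu A ->
        transport_entropy alpha mu
          (Num.max (((p - 1) * A) `^ (r - 1)) (((p - 1) * A) `^ (p - 1)))
    & forall A : R, 0 < A -> LSI_minus alpha mu A ->
        transport_entropy alpha mu
          ((1 + (p - 1) * A) `^ (p - r) * ((p - 1) * A) `^ (r - 1))].
Proof.
move=> r p.
have r1 : 1 <= r := r_exponent_ge1 alpha_young.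
have rp : r <= p := r_exponent_le_p alpha_young alpha_delta2.
have p1 : 1 < p := p_exponent_gt1 alpha_young alpha_delta2.
have main part A : part = (@pos_part R) \/ part = (@neg_part R) -> 0 < A ->
    LSI mu part alpha A -> transport_entropy alpha mu
      (Num.max (((p - 1) * A) `^ (r - 1)) (((p - 1) * A) `^ (p - 1))).
  move=> hpart A0 lsi.
  have a0 : 0 < (p - 1) * A by rewrite mulr_gt0// subr_gt0.
  apply: (transport_entropy_of_exp_integral alpha_young alpha_delta2 X_separable).
    by rewrite lt_max powR_gt0.
  move=> k phi psi k1 bphi bpsi H.
  exact: (LSI_exp_integral_le hpart alpha_young alpha_delta2 A0 lsi k1 bphi bpsi H).
split=> // A A0 lsi; first by apply: (main (@pos_part R)) => //; left.
have a0 : 0 < (p - 1) * A by rewrite mulr_gt0// subr_gt0.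
apply: transport_entropy_le (main (@neg_part R) A _ A0 lsi) => //; last by right.
  by rewrite lt_max powR_gt0.
set a := (p - 1) * A in a0 *.
have pr0 : 0 <= p - r by rewrite subr_ge0.
have ar : 0 <= a `^ (r - 1) := powR_ge0 _ _.
(* The terms of the maximum are a^(r-1) times 1 and times a^(p-r), and (1 + a)^(p-r) is at least
   both factors. *)
rewrite ge_max; apply/andP; split.
  rewrite ler_peMl// -[leLHS](powRr0 (1 + a)).
  by apply: ler_powR => //; rewrite lerDl ltW.
have -> : a `^ (p - 1) = a `^ ((p - r) + (r - 1)) by congr (_ `^ _); ring.
rewrite powRD; last by apply/implyP => _; rewrite gt_eqF.
apply: ler_wpM2r => //; apply: ge0_ler_powR => //; rewrite ?nnegrE; lra.
Qed.
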